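(* Let $\alpha>-1$ and let $\widetilde H_\alpha=\mathcal{L}_\alpha^{-1}H_\alpha\mathcal{L}_\alpha$ act in $\ell^2(\mathbb{Z}_{\ge0};\sigma_\alpha^2)$. Then $\widetilde H_\alpha$ is Markovian, that is, the corresponding semigroup $$e^{-t\widetilde H_\alpha}=\mathcal{L}_\alpha^{-1}e^{-tH_\alpha}\mathcal{L}_\alpha,\qquad t>0,$$ is positivity preserving and $\ell^\infty$ contractive.
   Context: For $\alpha>-1$ and a complex sequence $u=(u_n)_{n\ge 0}$ (with $u_{-1}:=0$) put $$(\tau_\alpha u)_n=-\sqrt{n(n+\alpha)}\,u_{n-1}+(2n+1+\alpha)u_n-\sqrt{(n+1)(n+1+\alpha)}\,u_{n+1},\quad n\ge 0.$$ The discrete Laguerre operator $H_\alpha$ in $\ell^2(\mathbb{Z}_{\ge 0})$ is $H_\alpha u=\tau_\alpha u$ with domain $\{u\in\ell^2(\mathbb{Z}_{\ge0}) : \tau_\alpha u\in\ell^2(\mathbb{Z}_{\ge0})\}$; it is self-adjoint and nonnegative. $\sigma_\alpha(n):=\left(\frac{(\alpha+1)_n}{n!}\right)^{1/2}$, where $(x)_0:=1$, $(x)_n:=x(x+1)\cdots(x+n-1)$ for $n\ge1$. $\ell^2(\mathbb{Z}_{\ge0};\sigma_\alpha^2)$ is the Hilbert space of sequences with $\sum_n|u_n|^2\sigma_\alpha(n)^2<\infty$, and $\mathcal{L}_\alpha:(u_n)_{n\ge0}\mapsto(\sigma_\alpha(n)u_n)_{n\ge0}$ is an isometric isomorphism of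 it onto $\ell^2(\mathbb{Z}_{\ge0})$. Positivity preserving: nonnegative sequences are mapped to nonnegative sequences. $\ell^\infty$ contractive: $\sup_n|(e^{-t\widetilde H_\alpha}u)_n|\le\sup_n|u_n|$ for all bounded $u\in\ell^2(\mathbb{Z}_{\ge0};\sigma_\alpha^2)$ and $t>0$. *)

(* Defs.v *)
(* Stdlib reals with Coquelicot. *)
From Stdlib Require Import Reals Factorial.
From Coquelicot Require Import Coquelicot.

Open Scope R_scope.

(** ** Weighted l^2 spaces of complex sequences *)

(** [ell2 w] is l^2(Z_{>=0}; w): the weight [w] multiplies |u_n|^2. *)
Definition ell2 (w : nat -> R) (u : nat -> C) : Prop :=
  ex_series (fun n => Cmod (u n) ^ 2 * w n).

(** Only meaningful on [ell2 w], since [Series] is total. *)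
Definition ell2_norm (w : nat -> R) (u : nat -> C) : R :=
  sqrt (Series (fun n => Cmod (u n) ^ 2 * w n)).

Definition unit_weight (n : nat) : R := 1.

(** ** Unbounded operators and the semigroups they generate *)

(** [act A u] is only meaningful when [dom A u] holds. *)
Record operator := Operator {
  dom : (nat -> C) -> Prop;
  act : (nat -> C) -> nat -> C
}.

(** A strongly continuous one-parameter semigroup of bounded linear operators
    on [ell2 w]; nothing is said about the values of [T t] for [t < 0] or
    outside [ell2 w]. *)
Record C0_semigroup (w : nat -> R) (T : R -> (nat -> C) -> nat -> C) : Prop := {
  C0_maps : forall t u, 0 <= t -> ell2 w u -> ell2 w (T t u);
  C0_linear : forall t (a b : C) u v, 0 <= t -> ell2 w u -> ell2 w v ->
    forall n, T t (fun k => a * u k + b * v k)%C n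
              = (a * T t u n + b * T t v n)%C;
  C0_bounded : forall t, 0 <= t -> exists M : R, forall u, ell2 w u ->
    ell2_norm w (T t u) <= M * ell2_norm w u;
  C0_zero : forall u, ell2 w u -> forall n, T 0 u n = u n;
  C0_add : forall s t u, 0 <= s -> 0 <= t -> ell2 w u ->
    forall n, T (s + t) u n = T s (T t u) n;
  C0_continuous : forall u, ell2 w u ->
    filterlim (fun t => ell2_norm w (fun n => T t u n - u n)%C)
              (at_right 0) (locally 0)
}.

(** [v] is the [ell2 w]-limit of (T_t u - u)/t as t decreases to 0. *)
Definition generator_at (w : nat -> R) (T : R -> (nat -> C) -> nat -> C)
    (u v : nat -> C) : Prop :=
  filterlim
    (fun t => ell2_norm w (fun n => RtoC (/ t) * (T t u n - u n) - v n)%C)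
    (at_right 0) (locally 0).

(** T_t = e^{-tA}: the infinitesimal generator of [T] is exactly -A, domains
    included.  A C_0-semigroup is determined by its generator, and for [A]
    self-adjoint and nonnegative it is the functional-calculus e^{-tA}. *)
Definition exp_semigroup (w : nat -> R) (A : operator)
    (T : R -> (nat -> C) -> nat -> C) : Prop :=
  C0_semigroup w T /\
  forall u v, ell2 w u -> ell2 w v ->
    (generator_at w T u v <-> dom A u /\ forall n, v n = (- act A u n)%C).

(** ** Markov property *)

Definition nonneg_seq (u : nat -> C) : Prop :=
  forall n, Im (u n) = 0 /\ 0 <= Re (u n).

Definition positivity_preserving (w : nat -> R)
    (T : R -> (nat -> C) -> nat -> C) : Prop :=
  forall t u, 0 < t -> ell2 w u -> nonneg_seq u -> nonneg_seq (T t u).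

Definition bounded_seq (u : nat -> C) : Prop :=
  exists M : R, forall n, Cmod (u n) <= M.

Definition sup_norm (u : nat -> C) : Rbar :=
  Sup_seq (fun n => Finite (Cmod (u n))).

Definition linfty_contractive (w : nat -> R)
    (T : R -> (nat -> C) -> nat -> C) : Prop :=
  forall t u, 0 < t -> ell2 w u -> bounded_seq u ->
    Rbar_le (sup_norm (T t u)) (sup_norm u).

(** ** The discrete Laguerre operator *)

Definition tau (alpha : R) (u : nat -> C) (n : nat) : C :=
  let x := INR n in
  (- RtoC (sqrt (x * (x + alpha)))
       * (match n with O => RtoC 0 | S m => u m end)
   + RtoC (2 * x + 1 + alpha) * u n
   - RtoC (sqrt ((x + 1) * (x + 1 + alpha))) * u (S n))%C.

Definition laguerre (alpha : R) : operator := {|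
  dom := fun u => ell2 unit_weight u /\ ell2 unit_weight (tau alpha u);
  act := tau alpha
|}.

(** Rising factorial x (x+1) ... (x+n-1). *)
Fixpoint pochhammer (x : R) (n : nat) : R :=
  match n with
  | O => 1
  | S k => pochhammer x k * (x + INR k)
  end.

Definition sigma (alpha : R) (n : nat) : R :=
  sqrt (pochhammer (alpha + 1) n / INR (fact n)).

Definition sigma2 (alpha : R) (n : nat) : R := sigma alpha n ^ 2.

Definition Lmap (alpha : R) (u : nat -> C) (n : nat) : C :=
  (RtoC (sigma alpha n) * u n)%C.

(** Inverse of [Lmap alpha]; [sigma alpha n > 0] when [alpha > -1]. *)
Definition Lmap_inv (alpha : R) (u : nat -> C) (n : nat) : C :=
  (RtoC (/ sigma alpha n) * u n)%C.

Definition laguerre_tilde (alpha : R) : operator := {|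
  dom := fun u => ell2 (sigma2 alpha) u /\ dom (laguerre alpha) (Lmap alpha u);
  act := fun u => Lmap_inv alpha (act (laguerre alpha) (Lmap alpha u))
|}.

Definition conj_semigroup (alpha : R) (T : R -> (nat -> C) -> nat -> C)
    (t : R) (u : nat -> C) : nat -> C :=
  Lmap_inv alpha (T t (Lmap alpha u)).

(* Main.v *)
From Stdlib Require Import Reals Lra Lia.
From Stdlib Require Import Classical ClassicalEpsilon FunctionalExtensionality.
From Coquelicot Require Import Coquelicot.
Require Import Defs.

Open Scope R_scope.

(** Put [y n = u n / sigma n].  In this variable [tau alpha] becomes
    [(2n + 1 + alpha) y n - n y (n-1) - (n + 1 + alpha) y (n+1)], which is minus
    the generator of a birth-death process and annihilates the constants.  The
    Markov property is therefore a maximum principle: if [Re (u n) <= M sigma n]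
    for all [n], with [0 <= M], then also [Re (T t u n) <= M sigma n].  Applied
    to [c u] for complex [c] it gives everything: positivity by taking [M = 0]
    and [c] among [-1], [Ci], [- Ci], and contractivity by taking for [c] the
    conjugate of the coordinate of [T t u] to be bounded.

    The maximum principle comes from an energy, the sum of the squares of the
    excesses [max 0 (Re (u n) - M sigma n)] (Stampacchia's truncation).  For [u]
    in the maximal domain the pairing of the excess of [u] with [Re (tau u)] is
    nonnegative ([excess_tau_nonneg]): summation by parts turns it into a sum of
    nonnegative bond terms ([excess_tau_partial_sum]) and a boundary term which
    vanishes along a subsequence, since [N |u N| |u (N+1)|] cannot stay away from
    0 for a square-summable [u].  As the domain is invariant under [T t], the
    right derivative of the energy along an orbit is at most 0
    ([energy_right_dini]).

    To conclude that the energy does not increase one also needs the orbit to be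
    continuous from the left, which for a strongly continuous semigroup rests on
    the uniform boundedness principle ([uniform_boundedness],
    [semigroup_locally_bounded]).  Finitely supported sequences lie in the
    domain, so truncation extends the principle from the domain to all of l^2
    ([barrier_small_time]), and the semigroup law extends it from short times to
    all times ([barrier]).

    That the conjugated family is the semigroup generated by the conjugated
    operator holds because [Lmap alpha] is isometric and invertible
    ([conj_exp_semigroup]). *)

(** * Square-summable sequences *)

Local Notation l2 := (ell2 unit_weight).
Local Notation nrm := (ell2_norm unit_weight).

Lemma sum_n_nonneg (a : nat -> R) N : (forall n, 0 <= a n) -> 0 <= sum_n a N.
Proof.
  intros Ha; induction N as [|N IH].
  - rewrite sum_O; apply Ha.
  - rewrite sum_Sn. apply Rplus_le_le_0_compat; [exact IH | apply Ha].
Qed.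

Lemma sum_n_mono (a b : nat -> R) N :
  (forall n, a n <= b n) -> sum_n a N <= sum_n b N.
Proof.
  intros Hab; induction N as [|N IH].
  - rewrite !sum_O; apply Hab.
  - rewrite !sum_Sn. apply Rplus_le_compat; [exact IH | apply Hab].
Qed.

Lemma sum_n_le_Series (a : nat -> R) N :
  (forall n, 0 <= a n) -> ex_series a -> sum_n a N <= Series a.
Proof.
  intros Ha Hex.
  apply (is_lim_seq_incr_compare (sum_n a) (Series a)).
  - exact (Series_correct _ Hex).
  - intros n; rewrite sum_Sn. generalize (Ha (S n)).
    change (plus (sum_n a n) (a (S n))) with (sum_n a n + a (S n)). lra.
Qed.

Lemma term_le_Series (a : nat -> R) N :
  (forall n, 0 <= a n) -> ex_series a -> a N <= Series a.
Proof.
  intros Ha Hex.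
  apply Rle_trans with (sum_n a N); [|now apply sum_n_le_Series].
  destruct N as [|N]; [rewrite sum_O; lra|].
  rewrite sum_Sn. generalize (sum_n_nonneg a N Ha).
  change (plus (sum_n a N) (a (S N))) with (sum_n a N + a (S N)). lra.
Qed.

Lemma Series_nonneg (a : nat -> R) :
  (forall n, 0 <= a n) -> ex_series a -> 0 <= Series a.
Proof.
  intros Ha Hex. apply Rle_trans with (a O); [apply Ha|now apply term_le_Series].
Qed.

(** The form in which completeness of the reals enters: a bound on finite sums
    passes to coordinatewise limits, as in Fatou's lemma. *)
Lemma series_of_bounded_sums (a : nat -> R) K :
  (forall n, 0 <= a n) -> (forall N, sum_n a N <= K) ->
  ex_series a /\ Series a <= K.
Proof.
  intros Ha HK.
  assert (Hex : ex_series a).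
  { destruct (ex_finite_lim_seq_incr (sum_n a) K) as [l Hl]; [|exact HK|].
    - intros n; rewrite sum_Sn. generalize (Ha (S n)).
      change (plus (sum_n a n) (a (S n))) with (sum_n a n + a (S n)). lra.
    - exists l; exact Hl. }
  split; [exact Hex|].
  apply (is_lim_seq_le (sum_n a) (fun _ => K) (Series a) K HK).
  - exact (Series_correct _ Hex).
  - apply is_lim_seq_const.
Qed.

Lemma ex_series_dom (a b : nat -> R) :
  (forall n, Rabs (a n) <= b n) -> ex_series b -> ex_series a.
Proof. exact (@ex_series_le R_AbsRing R_CompleteNormedModule a b). Qed.

Lemma ex_series_Rplus (a b : nat -> R) :
  ex_series a -> ex_series b -> ex_series (fun n => a n + b n).
Proof. exact (ex_series_plus (V := R_NormedModule) a b). Qed.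

Lemma ex_series_Rscal c (a : nat -> R) :
  ex_series a -> ex_series (fun n => c * a n).
Proof. exact (ex_series_scal_l (K := R_AbsRing) c a). Qed.

Lemma ex_series_Rminus (a b : nat -> R) :
  ex_series a -> ex_series b -> ex_series (fun n => a n - b n).
Proof. exact (ex_series_minus (V := R_NormedModule) a b). Qed.

Lemma l2_sq u : l2 u <-> ex_series (fun n => Cmod (u n) ^ 2).
Proof.
  unfold ell2, unit_weight.
  split; apply ex_series_ext; intros n; simpl; ring.
Qed.

Lemma nrm_def u : nrm u = sqrt (Series (fun n => Cmod (u n) ^ 2)).
Proof.
  unfold ell2_norm, unit_weight.
  f_equal; apply Series_ext; intros n; ring.
Qed.

Lemma nrm_nonneg u : 0 <= nrm u.
Proof. apply sqrt_pos. Qed.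

Lemma nrm_sq u : l2 u -> nrm u ^ 2 = Series (fun n => Cmod (u n) ^ 2).
Proof.
  intros Hu; rewrite nrm_def; apply pow2_sqrt, Series_nonneg.
  - intros n; apply pow2_ge_0.
  - now apply l2_sq.
Qed.

Lemma l2_finite_support N (u : nat -> C) :
  (forall n, (N <= n)%nat -> u n = 0) -> l2 u.
Proof.
  intros Hz. apply l2_sq. apply (ex_series_incr_n _ N).
  apply (ex_series_dom _ (fun n => 0 * (1 / 2) ^ n)).
  - intros n. rewrite Hz by lia. rewrite Cmod_0. simpl. rewrite !Rmult_0_l, Rabs_R0. lra.
  - apply ex_series_Rscal, ex_series_geom. rewrite Rabs_pos_eq; lra.
Qed.

Lemma l2_zero : l2 (fun _ => RtoC 0).
Proof. now apply (l2_finite_support 0). Qed.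

Lemma nrm_zero : nrm (fun _ => RtoC 0) = 0.
Proof.
  rewrite nrm_def, (Series_ext _ (fun _ => 0 * 0)).
  - rewrite Series_scal_l, Rmult_0_l. apply sqrt_0.
  - intros n. rewrite Cmod_0. simpl; ring.
Qed.

Lemma l2_nrm_intro u K :
  0 <= K -> (forall N, sum_n (fun n => Cmod (u n) ^ 2) N <= K ^ 2) ->
  l2 u /\ nrm u <= K.
Proof.
  intros HK Hs.
  destruct (series_of_bounded_sums (fun n => Cmod (u n) ^ 2) (K ^ 2))
    as [Hex Hle]; [intros n; apply pow2_ge_0 | exact Hs |].
  split; [now apply l2_sq|].
  rewrite nrm_def, <- (sqrt_pow2 K HK). now apply sqrt_le_1_alt.
Qed.

Lemma sum_n_le_nrm_sq u N :
  l2 u -> sum_n (fun n => Cmod (u n) ^ 2) N <= nrm u ^ 2.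
Proof.
  intros Hu; rewrite (nrm_sq u Hu); apply sum_n_le_Series.
  - intros n; apply pow2_ge_0.
  - now apply l2_sq.
Qed.

Lemma coord_le_nrm u n : l2 u -> Cmod (u n) <= nrm u.
Proof.
  intros Hu.
  apply Rsqr_incr_0; [|apply Cmod_ge_0|apply nrm_nonneg].
  rewrite !Rsqr_pow2, (nrm_sq u Hu).
  apply (term_le_Series (fun n => Cmod (u n) ^ 2)).
  - intros k; apply pow2_ge_0.
  - now apply l2_sq.
Qed.

(** The real sequences are only required to be dominated by the moduli of [u]
    and [v], because the pairings that occur below are between real parts,
    positive parts and moduli of complex sequences, never between the complex
    sequences themselves. *)
Lemma cauchy_schwarz (a b : nat -> R) u v :
  l2 u -> l2 v ->
  (forall n, Rabs (a n) <= Cmod (u n)) -> (forall n, Rabs (b n) <= Cmod (v n)) ->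
  ex_series (fun n => a n * b n) /\
  Rabs (Series (fun n => a n * b n)) <= nrm u * nrm v.
Proof.
  intros Hu Hv Ha Hb.
  assert (Hu' := proj1 (l2_sq u) Hu). assert (Hv' := proj1 (l2_sq v) Hv).
  set (p := fun n => Cmod (u n) * Cmod (v n)).
  assert (Hp0 : forall n, 0 <= p n)
    by (intros n; apply Rmult_le_pos; apply Cmod_ge_0).
  assert (Hp : ex_series p).
  { apply ex_series_dom with (fun n => Cmod (u n) ^ 2 + Cmod (v n) ^ 2).
    - intros n; rewrite Rabs_pos_eq by apply Hp0. unfold p.
      generalize (Cmod_ge_0 (u n)) (Cmod_ge_0 (v n)).
      generalize (Cmod (u n)) (Cmod (v n)). intros; nra.
    - now apply ex_series_Rplus. }
  assert (Hdom : forall n, Rabs (a n * b n) <= p n).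
  { intros n; rewrite Rabs_mult. unfold p.
    apply Rmult_le_compat; auto using Rabs_pos. }
  assert (Habs : ex_series (fun n => Rabs (a n * b n))).
  { apply ex_series_dom with p; [|exact Hp].
    intros n; rewrite Rabs_Rabsolu; apply Hdom. }
  split; [now apply ex_series_dom with p|].
  apply Rle_trans with (1 := Series_Rabs _ Habs).
  apply Rle_trans with (Series p).
  { apply Series_le; [|exact Hp]. intros n; split; [apply Rabs_pos|apply Hdom]. }
  set (P := Series p).
  assert (HP : 0 <= P) by now apply Series_nonneg.
  set (A := nrm u). set (B := nrm v).
  assert (HA : 0 <= A) by apply nrm_nonneg.
  assert (HB : 0 <= B) by apply nrm_nonneg.
  (* the sum of the squares (s |u n| - |v n|)^2 is a nonnegative quadratic in s *)
  assert (Hq : forall s, 2 * s * P <= s ^ 2 * A ^ 2 + B ^ 2).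
  { intros s. unfold A, B, P. rewrite (nrm_sq u Hu), (nrm_sq v Hv).
    rewrite <- !Series_scal_l.
    rewrite <- Series_plus;
      [|now apply (ex_series_Rscal (s ^ 2)) |exact Hv'].
    enough (0 <= Series (fun n =>
        (s ^ 2 * Cmod (u n) ^ 2 + Cmod (v n) ^ 2) - 2 * s * p n)) as H.
    { rewrite Series_minus in H; [lra| |].
      - apply ex_series_Rplus; [|exact Hv'].
        now apply (ex_series_Rscal (s ^ 2)).
      - now apply (ex_series_Rscal (2 * s)). }
    apply Series_nonneg.
    - intros n; unfold p.
      replace (s ^ 2 * Cmod (u n) ^ 2 + Cmod (v n) ^ 2
                 - 2 * s * (Cmod (u n) * Cmod (v n)))
        with ((s * Cmod (u n) - Cmod (v n)) ^ 2) by ring.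
      apply pow2_ge_0.
    - apply ex_series_Rminus.
      + apply ex_series_Rplus; [|exact Hv'].
        now apply (ex_series_Rscal (s ^ 2)).
      + now apply (ex_series_Rscal (2 * s)). }
  apply Rsqr_incr_0; [|exact HP|now apply Rmult_le_pos].
  rewrite !Rsqr_pow2.
  destruct (Req_dec A 0) as [HA0|HA0].
  (* [A = 0]: the inequality is affine in s, and this s contradicts P > 0 *)
  - destruct (Req_dec P 0) as [HP0|HP0].
    { rewrite HP0, HA0. right; ring. }
    exfalso. generalize (Hq ((B ^ 2 + 1) / P)). rewrite HA0.
    replace (2 * ((B ^ 2 + 1) / P) * P) with (2 * (B ^ 2 + 1)) by (now field).
    generalize (pow2_ge_0 B). intros H1 H2. ring_simplify in H2. lra.
  (* the minimum of the quadratic is at s = P / A^2 *)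
  - assert (HA2 : 0 < A ^ 2) by nra.
    generalize (Hq (P / A ^ 2)).
    replace ((P / A ^ 2) ^ 2 * A ^ 2 + B ^ 2) with ((P ^ 2 / A ^ 2) + B ^ 2)
      by (now field).
    replace (2 * (P / A ^ 2) * P) with (2 * (P ^ 2 / A ^ 2)) by (now field).
    intros H.
    replace (P ^ 2) with (P ^ 2 / A ^ 2 * A ^ 2) by (now field).
    replace ((A * B) ^ 2) with (B ^ 2 * A ^ 2) by ring.
    apply Rmult_le_compat_r; lra.
Qed.

Lemma l2_scal c u : l2 u -> l2 (fun n => c * u n)%C.
Proof.
  intros Hu; apply l2_sq. apply l2_sq in Hu.
  apply ex_series_ext with (fun n => Cmod c ^ 2 * Cmod (u n) ^ 2).
  - intros n; rewrite Cmod_mult; simpl; ring.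
  - now apply (ex_series_Rscal (Cmod c ^ 2)).
Qed.

Lemma nrm_scal c u : nrm (fun n => c * u n)%C = Cmod c * nrm u.
Proof.
  rewrite !nrm_def.
  rewrite Series_ext with (b := fun n => Cmod c ^ 2 * Cmod (u n) ^ 2)
    by (intros n; rewrite Cmod_mult; ring).
  rewrite Series_scal_l, sqrt_mult_alt, sqrt_pow2; auto using pow2_ge_0, Cmod_ge_0.
Qed.

Lemma l2_plus_nrm u v : l2 u -> l2 v ->
  l2 (fun n => u n + v n)%C /\ nrm (fun n => u n + v n)%C <= nrm u + nrm v.
Proof.
  intros Hu Hv.
  destruct (cauchy_schwarz (fun n => Cmod (u n)) (fun n => Cmod (v n)) u v Hu Hv)
    as [Hex Hcs];
    try (intros n; rewrite Rabs_pos_eq; auto using Cmod_ge_0, Rle_refl).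
  assert (Hu' := proj1 (l2_sq u) Hu). assert (Hv' := proj1 (l2_sq v) Hv).
  apply l2_nrm_intro.
  { generalize (nrm_nonneg u) (nrm_nonneg v); lra. }
  intros N.
  set (b := fun n => (Cmod (u n) ^ 2 + Cmod (v n) ^ 2)
                     + 2 * (Cmod (u n) * Cmod (v n))).
  apply Rle_trans with (sum_n b N).
  { apply sum_n_mono. intros n. unfold b.
    generalize (Cmod_triangle (u n) (v n)) (Cmod_ge_0 (u n + v n)).
    generalize (Cmod (u n + v n)). intros; nra. }
  assert (Huv : ex_series (fun n => Cmod (u n) ^ 2 + Cmod (v n) ^ 2))
    by now apply ex_series_Rplus.
  assert (H2 : ex_series (fun n => 2 * (Cmod (u n) * Cmod (v n))))
    by now apply (ex_series_Rscal 2).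
  apply Rle_trans with (Series b).
  { apply sum_n_le_Series.
    - intros n; unfold b. generalize (Cmod_ge_0 (u n)) (Cmod_ge_0 (v n)); nra.
    - now apply ex_series_Rplus. }
  unfold b. rewrite Series_plus, Series_plus, Series_scal_l by assumption.
  rewrite <- (nrm_sq u Hu), <- (nrm_sq v Hv).
  apply Rabs_le_between in Hcs. nra.
Qed.

Lemma l2_plus u v : l2 u -> l2 v -> l2 (fun n => u n + v n)%C.
Proof. intros; now apply l2_plus_nrm. Qed.

Lemma nrm_triangle u v : l2 u -> l2 v ->
  nrm (fun n => u n + v n)%C <= nrm u + nrm v.
Proof. intros; now apply l2_plus_nrm. Qed.

Lemma l2_opp u : l2 u -> l2 (fun n => - u n)%C.
Proof.
  intros Hu.
  replace (fun n => - u n)%C with (fun n => - (1) * u n)%C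
    by (apply functional_extensionality; intros; ring).
  now apply l2_scal.
Qed.

Lemma minus_as_plus (u v : nat -> C) :
  (fun n => u n - v n)%C = (fun n => u n + (- (1)) * v n)%C.
Proof. apply functional_extensionality; intros n; ring. Qed.

Lemma l2_minus u v : l2 u -> l2 v -> l2 (fun n => u n - v n)%C.
Proof. intros; rewrite minus_as_plus. apply l2_plus; auto using l2_scal. Qed.

Lemma nrm_minus_triangle u v : l2 u -> l2 v ->
  nrm (fun n => u n - v n)%C <= nrm u + nrm v.
Proof.
  intros Hu Hv. rewrite minus_as_plus.
  apply Rle_trans with (1 := nrm_triangle _ _ Hu (l2_scal (- (1))%C v Hv)).
  rewrite nrm_scal, Cmod_opp, Cmod_1. lra.
Qed.

(** * Completeness and uniform boundedness *)

Lemma functional_choice (X Y : Type) (P : X -> Y -> Prop) :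
  (forall x, exists y, P x y) -> exists f, forall x, P x (f x).
Proof.
  intros H.
  exists (fun x => proj1_sig (constructive_indefinite_description _ (H x))).
  intros x; apply proj2_sig.
Qed.

Lemma geometric_cauchy_lim (a : nat -> R) :
  (forall k, Rabs (a (S k) - a k) <= (1 / 3) ^ k) -> exists l : R, is_lim_seq a l.
Proof.
  intros Ha.
  assert (Hex : ex_series (fun k => a (S k) - a k)).
  { apply ex_series_dom with (1 := Ha).
    apply ex_series_geom. rewrite Rabs_pos_eq; lra. }
  destruct Hex as [l Hl]. exists (l + a O).
  apply is_lim_seq_incr_1.
  apply is_lim_seq_ext with (fun k => sum_n (fun k => a (S k) - a k) k + a O).
  - intros k; induction k as [|k IH].
    + rewrite sum_O; ring.
    + rewrite sum_Sn.
      change plus with Rplus. cbv beta. lra.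
  - apply is_lim_seq_plus'; [exact Hl | apply is_lim_seq_const].
Qed.

Lemma geometric_steps (X : nat -> nat -> C) :
  (forall k, l2 (X k)) ->
  (forall k, nrm (fun n => X (S k) n - X k n)%C <= (1 / 3) ^ k) ->
  forall k j,
    nrm (fun n => X (k + j)%nat n - X k n)%C
      <= 3 / 2 * (1 / 3) ^ k * (1 - (1 / 3) ^ j).
Proof.
  intros HX Hd k j; induction j as [|j IH].
  - rewrite Nat.add_0_r. simpl pow at 2.
    replace (fun n => X k n - X k n)%C with (fun _ : nat => RtoC 0)
      by (apply functional_extensionality; intros; ring).
    rewrite nrm_zero. lra.
  - rewrite Nat.add_succ_r.
    replace (fun n => X (S (k + j)) n - X k n)%C
      with (fun n => (X (S (k + j)) n - X (k + j)%nat n)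
                     + (X (k + j)%nat n - X k n))%C
      by (apply functional_extensionality; intros; ring).
    eapply Rle_trans; [apply nrm_triangle; now apply l2_minus|].
    specialize (Hd (k + j)%nat). rewrite pow_add in Hd. simpl pow at 2.
    simpl pow in IH |- *. lra.
Qed.

Lemma Cmod_minus_sq (a b : C) :
  Cmod (a - b) ^ 2 = (Re a - Re b) * (Re a - Re b) + (Im a - Im b) * (Im a - Im b).
Proof. rewrite Cmod2_alt. destruct a, b; simpl. ring. Qed.

(** Completeness, for sequences whose steps shrink like [3^-k]: the limit is
    taken in each coordinate, and the tail bound of the geometric series
    survives because it is a bound on finite sums. *)
Lemma l2_complete (X : nat -> nat -> C) :
  (forall k, l2 (X k)) ->
  (forall k, nrm (fun n => X (S k) n - X k n)%C <= (1 / 3) ^ k) ->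
  exists x, l2 x /\ forall k, nrm (fun n => x n - X k n)%C <= 3 / 2 * (1 / 3) ^ k.
Proof.
  intros HX Hd.
  assert (Hc : forall n k, Cmod (X (S k) n - X k n) <= (1 / 3) ^ k).
  { intros n k. apply Rle_trans with (2 := Hd k).
    apply (coord_le_nrm (fun n => X (S k) n - X k n)%C). now apply l2_minus. }
  assert (Hre : forall n, exists l : R, is_lim_seq (fun k => Re (X k n)) l).
  { intros n; apply geometric_cauchy_lim. intros k.
    apply Rle_trans with (2 := Hc n k).
    replace (Re (X (S k) n) - Re (X k n)) with (Re (X (S k) n - X k n)%C)
      by reflexivity.
    apply re_le_Cmod. }
  assert (Him : forall n, exists l : R, is_lim_seq (fun k => Im (X k n)) l).
  { intros n; apply geometric_cauchy_lim. intros k.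
    apply Rle_trans with (2 := Hc n k).
    replace (Im (X (S k) n) - Im (X k n)) with (Im (X (S k) n - X k n)%C)
      by reflexivity.
    eapply Rle_trans; [apply Rmax_r | apply Rmax_Cmod]. }
  apply functional_choice in Hre. destruct Hre as [xr Hr].
  apply functional_choice in Him. destruct Him as [xi Hi].
  set (x := fun n => (xr n, xi n) : C).
  assert (Hgap : forall k, l2 (fun n => x n - X k n)%C /\
                           nrm (fun n => x n - X k n)%C <= 3 / 2 * (1 / 3) ^ k).
  { intros k. assert (Hpk : 0 < (1 / 3) ^ k) by (apply pow_lt; lra).
    apply l2_nrm_intro; [lra|]. intros N.
    (* the coordinatewise limit in j of the bounds on X (k + j) - X k *)
    apply (is_lim_seq_le
             (fun j => sum_n (fun n => Cmod (X (k + j)%nat n - X k n) ^ 2) N)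
             (fun _ => (3 / 2 * (1 / 3) ^ k) ^ 2)
             (sum_n (fun n => Cmod (x n - X k n) ^ 2) N)
             ((3 / 2 * (1 / 3) ^ k) ^ 2)).
    - intros j.
      eapply Rle_trans;
        [apply (sum_n_le_nrm_sq (fun n => X (k + j)%nat n - X k n)%C);
         now apply l2_minus|].
      apply pow_incr. split; [apply nrm_nonneg|].
      apply Rle_trans with (1 := geometric_steps X HX Hd k j).
      assert (0 < (1 / 3) ^ j) by (apply pow_lt; lra). nra.
    - assert (Hterm : forall n, is_lim_seq
                (fun j => Cmod (X (k + j)%nat n - X k n) ^ 2)
                (Cmod (x n - X k n) ^ 2)).
      { intros n.
        apply is_lim_seq_ext with (fun j =>
          (Re (X (k + j)%nat n) - Re (X k n)) * (Re (X (k + j)%nat n) - Re (X k n))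
          + (Im (X (k + j)%nat n) - Im (X k n)) * (Im (X (k + j)%nat n) - Im (X k n))).
        { intros j; now rewrite Cmod_minus_sq. }
        replace (Cmod (x n - X k n) ^ 2) with
          ((xr n - Re (X k n)) * (xr n - Re (X k n))
           + (xi n - Im (X k n)) * (xi n - Im (X k n)))
          by (rewrite Cmod_minus_sq; reflexivity).
        assert (Hr' : is_lim_seq (fun j => Re (X (k + j)%nat n)) (xr n)).
        { apply is_lim_seq_ext with (fun j => Re (X (j + k)%nat n)).
          - intros; now rewrite Nat.add_comm.
          - apply (is_lim_seq_incr_n (fun j => Re (X j n)) k), Hr. }
        assert (Hi' : is_lim_seq (fun j => Im (X (k + j)%nat n)) (xi n)).
        { apply is_lim_seq_ext with (fun j => Im (X (j + k)%nat n)).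
          - intros; now rewrite Nat.add_comm.
          - apply (is_lim_seq_incr_n (fun j => Im (X j n)) k), Hi. }
        apply is_lim_seq_plus'; apply is_lim_seq_mult';
          apply is_lim_seq_minus'; auto using is_lim_seq_const. }
      induction N as [|N IH].
      + rewrite sum_O.
        apply is_lim_seq_ext with (fun j => Cmod (X (k + j)%nat O - X k O) ^ 2);
          [intros j; now rewrite sum_O | apply Hterm].
      + rewrite sum_Sn.
        apply is_lim_seq_ext with
          (fun j => sum_n (fun n => Cmod (X (k + j)%nat n - X k n) ^ 2) N
                    + Cmod (X (k + j)%nat (S N) - X k (S N)) ^ 2);
          [intros j; now rewrite sum_Sn | now apply is_lim_seq_plus'].
    - apply is_lim_seq_const. }
  exists x; split; [|intros k; apply Hgap].
  replace x with (fun n => (x n - X O n) + X O n)%C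
    by (apply functional_extensionality; intros; ring).
  apply l2_plus; [apply Hgap | apply HX].
Qed.

Record bounded_linear (S : (nat -> C) -> nat -> C) : Prop := {
  bl_maps : forall u, l2 u -> l2 (S u);
  bl_linear : forall (a b : C) u v, l2 u -> l2 v ->
    S (fun n => a * u n + b * v n)%C = (fun n => a * S u n + b * S v n)%C;
  bl_bounded : exists M, forall u, l2 u -> nrm (S u) <= M * nrm u
}.

Lemma bl_scal S c u : bounded_linear S -> l2 u ->
  S (fun n => c * u n)%C = (fun n => c * S u n)%C.
Proof.
  intros HS Hu.
  replace (fun n => c * u n)%C with (fun n => c * u n + 0 * u n)%C
    by (apply functional_extensionality; intros; ring).
  rewrite (bl_linear _ HS) by assumption.
  apply functional_extensionality; intros; ring.
Qed.

Lemma bl_minus S u v : bounded_linear S -> l2 u -> l2 v ->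
  S (fun n => u n - v n)%C = (fun n => S u n - S v n)%C.
Proof.
  intros HS Hu Hv. rewrite minus_as_plus.
  replace (fun n => u n + - (1) * v n)%C with (fun n => 1 * u n + - (1) * v n)%C
    by (apply functional_extensionality; intros; ring).
  rewrite (bl_linear _ HS) by assumption.
  apply functional_extensionality; intros; ring.
Qed.

(** The first component is the operator norm, a least upper bound over the unit
    ball.  It need not be attained; any fraction above 1/2 of it suffices for
    the gliding hump below. *)
Lemma near_maximizer S K : bounded_linear S -> 0 <= K ->
  ~ (forall u, l2 u -> nrm (S u) <= K * nrm u) ->
  exists Le : R * (nat -> C),
    K < fst Le /\ l2 (snd Le) /\ nrm (snd Le) <= 1 /\
    3 / 4 * fst Le <= nrm (S (snd Le)) /\
    forall u, l2 u -> nrm (S u) <= fst Le * nrm u.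
Proof.
  intros HS HK Hnot.
  destruct (bl_bounded _ HS) as [M HM].
  set (E := fun y => exists u, l2 u /\ nrm u <= 1 /\ y = nrm (S u)).
  destruct (completeness E) as [L [HLub HLleast]].
  { exists (Rabs M). intros y (u & Hu & Hu1 & ->).
    apply Rle_trans with (1 := HM u Hu).
    generalize (nrm_nonneg u) (Rle_abs M) (Rabs_pos M). nra. }
  { exists (nrm (S (fun _ => RtoC 0))), (fun _ => RtoC 0).
    split; [exact l2_zero|]. rewrite nrm_zero. split; [lra | reflexivity]. }
  assert (HL : forall u, l2 u -> nrm (S u) <= L * nrm u).
  { intros u Hu. destruct (Req_dec (nrm u) 0) as [Hz|Hz].
    - generalize (HM u Hu). rewrite Hz. lra.
    - assert (Hp : 0 < nrm u) by (generalize (nrm_nonneg u); lra).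
      assert (Hc : Cmod (/ nrm u) = / nrm u).
      { rewrite <- RtoC_inv, Cmod_R, Rabs_pos_eq; auto.
        now apply Rlt_le, Rinv_0_lt_compat. }
      assert (Hl : nrm (S (fun n => / nrm u * u n)%C) <= L).
      { apply HLub. exists (fun n => / nrm u * u n)%C. repeat split.
        - now apply l2_scal.
        - rewrite nrm_scal, Hc, Rinv_l; lra. }
      rewrite (bl_scal S) in Hl by assumption.
      rewrite nrm_scal, Hc in Hl.
      apply Rmult_le_compat_l with (r := nrm u) in Hl; [|lra].
      rewrite <- Rmult_assoc, Rinv_r, Rmult_1_l in Hl by lra. lra. }
  assert (HKL : K < L).
  { apply Rnot_le_lt; intros Hle. apply Hnot; intros u Hu.
    apply Rle_trans with (1 := HL u Hu).
    apply Rmult_le_compat_r; [apply nrm_nonneg|assumption]. }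
  assert (Hex : exists u, l2 u /\ nrm u <= 1 /\ 3 / 4 * L <= nrm (S u)).
  { apply NNPP; intros Hno.
    assert (Hub : is_upper_bound E (3 / 4 * L)).
    { intros y (u & Hu & Hu1 & ->). apply Rnot_lt_le; intros Hlt.
      apply Hno. exists u. repeat split; auto; lra. }
    specialize (HLleast _ Hub). lra. }
  destruct Hex as (e & He & He1 & Hbig).
  exists (L, e); simpl; auto.
Qed.

(** [2 S q] is the difference of [S (p + q)] and [S (p - q)], so the triangle
    inequality forbids both of them to be shorter than [S q]. *)
Lemma choose_sign S p q : bounded_linear S -> l2 p -> l2 q ->
  exists s : R, Rabs s = 1 /\ nrm (S q) <= nrm (S (fun n => p n + s * q n)%C).
Proof.
  intros HS Hp Hq.
  assert (Hlin : forall s : R, S (fun n => p n + s * q n)%C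
                               = (fun n => S p n + s * S q n)%C).
  { intros s.
    replace (fun n => p n + s * q n)%C with (fun n => 1 * p n + s * q n)%C
      by (apply functional_extensionality; intros; ring).
    rewrite (bl_linear _ HS) by assumption.
    apply functional_extensionality; intros; ring. }
  assert (HSp := bl_maps _ HS p Hp). assert (HSq := bl_maps _ HS q Hq).
  assert (Hsum : 2 * nrm (S q) <= nrm (S (fun n => p n + 1 * q n)%C)
                                + nrm (S (fun n => p n + (-1) * q n)%C)).
  { rewrite !Hlin.
    eapply Rle_trans; [|apply nrm_minus_triangle; auto using l2_plus, l2_scal].
    cbv beta.
    replace (fun n => S p n + 1 * S q n - (S p n + -1 * S q n))%C
      with (fun n => 2 * S q n)%C
      by (apply functional_extensionality; intros;
          apply injective_projections; simpl; ring).
    rewrite nrm_scal, Cmod_R, Rabs_pos_eq; lra. }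
  destruct (Rle_dec (nrm (S q)) (nrm (S (fun n => p n + 1 * q n)%C))) as [H|H].
  - exists 1. split; [apply Rabs_R1 | exact H].
  - exists (-1). split; [rewrite Rabs_left; lra | lra].
Qed.

(** Banach-Steinhaus by a gliding hump.  If the norms are unbounded, choose
    operators [G j] of norm [L j > 4 j 3^j] and near-maximizers [e j], and walk
    from 0 by the steps [+- 3^-j e j], each sign chosen so that [G j] moves the
    new point [X (j+1)] by at least [3^-j |G j (e j)| >= (3/4) 3^-j L j].  The
    limit lies within [(1/2) 3^-j] of [X (j+1)], so all the later steps together
    undo at most [(1/2) 3^-j L j], and the orbit of the limit is unbounded. *)
Theorem uniform_boundedness (F : nat -> (nat -> C) -> nat -> C) :
  (forall k, bounded_linear (F k)) ->
  (forall u, l2 u -> exists B, forall k, nrm (F k u) <= B) ->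
  exists M, forall k u, l2 u -> nrm (F k u) <= M * nrm u.
Proof.
  intros HF Hpt. apply NNPP; intros Hno.
  assert (Hk : forall j : nat, exists p : nat * (R * (nat -> C)),
    let k := fst p in let L := fst (snd p) in let e := snd (snd p) in
    4 * INR j * 3 ^ j < L /\ l2 e /\ nrm e <= 1 /\ 3 / 4 * L <= nrm (F k e) /\
    forall u, l2 u -> nrm (F k u) <= L * nrm u).
  { intros j.
    assert (Hj : exists k, ~ forall u, l2 u ->
                   nrm (F k u) <= (4 * INR j * 3 ^ j) * nrm u).
    { apply not_all_ex_not. intros Hall. apply Hno. eexists. exact Hall. }
    destruct Hj as [k Hkj].
    destruct (near_maximizer (F k) (4 * INR j * 3 ^ j) (HF k)) as [Le HLe];
      [|exact Hkj|].
    - apply Rmult_le_pos; [generalize (pos_INR j); lra | apply pow_le; lra].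
    - exists (k, Le). exact HLe. }
  apply functional_choice in Hk. destruct Hk as [sel Hsel]. simpl in Hsel.
  set (G := fun j => F (fst (sel j))).
  set (L := fun j => fst (snd (sel j))).
  set (e := fun j => snd (snd (sel j))).
  set (q := fun j n => (((1 / 3) ^ j)%R * e j n)%C).
  assert (HG : forall j, bounded_linear (G j)) by (intros; apply HF).
  assert (Hq : forall j, l2 (q j)) by (intros j; apply l2_scal, (Hsel j)).
  assert (Hpow : forall j, 0 < (1 / 3) ^ j) by (intros; apply pow_lt; lra).
  assert (Hcp : forall j, Cmod ((1 / 3) ^ j)%R = (1 / 3) ^ j)
    by (intros; rewrite Cmod_R; apply Rabs_pos_eq, Rlt_le, Hpow).
  assert (Hs : forall jp : nat * (nat -> C), exists s : R, l2 (snd jp) ->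
    Rabs s = 1 /\
    nrm (G (fst jp) (q (fst jp)))
      <= nrm (G (fst jp) (fun n => snd jp n + s * q (fst jp) n)%C)).
  { intros [j p]; simpl. destruct (classic (l2 p)) as [Hp|Hp].
    - destruct (choose_sign (G j) p (q j)) as [s Hs]; auto. exists s; auto.
    - exists 0; tauto. }
  apply functional_choice in Hs. destruct Hs as [sg Hsg].
  set (X := fix X j := match j with
            | O => fun _ => RtoC 0
            | S i => (fun n => X i n + sg (i, X i) * q i n)%C
            end).
  assert (HX : forall j, l2 (X j)).
  { induction j as [|j IH]; simpl.
    - exact l2_zero.
    - apply l2_plus; auto using l2_scal. }
  destruct (l2_complete X HX) as (x & Hx & Hlim).
  { intros j. simpl.
    replace (fun n => X j n + sg (j, X j) * q j n - X j n)%C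
      with (fun n => sg (j, X j) * q j n)%C
      by (apply functional_extensionality; intros; ring).
    destruct (Hsg (j, X j) (HX j)) as [Hs1 _].
    rewrite nrm_scal, Cmod_R, Hs1. unfold q. rewrite nrm_scal, Hcp.
    destruct (Hsel j) as (_ & _ & He & _). fold (e j) in He.
    generalize (Hpow j). nra. }
  destruct (Hpt x Hx) as [B HB].
  destruct (INR_unbounded B) as [j Hj].
  specialize (HB (fst (sel j))). fold (G j) in HB.
  destruct (Hsel j) as (HL & He & He1 & Hbig & Hop).
  fold (L j) in HL, Hbig, Hop. fold (e j) in He, He1, Hbig.
  fold (G j) in Hbig, Hop.
  destruct (Hsg (j, X j) (HX j)) as [_ Hfar]. simpl fst in Hfar. simpl snd in Hfar.
  change (fun n => X j n + sg (j, X j) * q j n)%C with (X (S j)) in Hfar.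
  assert (Hq3 : nrm (G j (q j)) = (1 / 3) ^ j * nrm (G j (e j))).
  { unfold q. rewrite (bl_scal (G j)) by auto. now rewrite nrm_scal, Hcp. }
  assert (Hdiff : nrm (G j (X (S j))) <= nrm (G j x) + L j * (3 / 2 * (1 / 3) ^ S j)).
  { replace (X (S j)) with (fun n => x n - (x n - X (S j) n))%C at 1
      by (apply functional_extensionality; intros; ring).
    rewrite (bl_minus (G j)) by auto using l2_minus.
    eapply Rle_trans;
      [apply nrm_minus_triangle; apply (bl_maps _ (HG j)); auto using l2_minus|].
    apply Rplus_le_compat_l.
    apply Rle_trans with (1 := Hop _ (l2_minus _ _ Hx (HX (S j)))).
    apply Rmult_le_compat_l; [|apply Hlim].
    apply Rle_trans with (2 := Rlt_le _ _ HL).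
    apply Rmult_le_pos; [generalize (pos_INR j); lra | apply pow_le; lra]. }
  simpl pow in Hdiff.
  (* 3/4 - 1/2 = 1/4, so that |G x| >= 3^-j L / 4 > j *)
  assert (H1 : (1 / 3) ^ j * (3 / 4 * L j) <= (1 / 3) ^ j * nrm (G j (e j)))
    by (apply Rmult_le_compat_l; [apply Rlt_le, Hpow | exact Hbig]).
  assert (H2 : (1 / 3) ^ j * (4 * INR j * 3 ^ j) < (1 / 3) ^ j * L j)
    by (apply Rmult_lt_compat_l; [apply Hpow | exact HL]).
  replace ((1 / 3) ^ j * (4 * INR j * 3 ^ j)) with (4 * INR j) in H2.
  - lra.
  - replace ((1 / 3) ^ j * (4 * INR j * 3 ^ j)) with (4 * INR j * ((1 / 3) ^ j * 3 ^ j)) by ring.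
    rewrite <- Rpow_mult_distr. replace (1 / 3 * 3) with 1 by field.
    rewrite pow1. ring.
Qed.

(** * Two facts of real analysis *)

(** A one-sided derivative bound alone does not exclude upward jumps; these are
    excluded by the second hypothesis, lower semicontinuity from the left.  For
    each slope [eps] the set of times up to which [f t <= f 0 + eps t] is closed
    on the right by the second hypothesis and open by the first. *)
Lemma nonincreasing_of_right_dini (f : R -> R) b : 0 <= b ->
  (forall t eps, 0 <= t < b -> 0 < eps -> exists d, 0 < d /\
     forall h, 0 < h < d -> f (t + h) <= f t + eps * h) ->
  (forall t eps, 0 < t <= b -> 0 < eps -> exists d, 0 < d /\
     forall h, 0 < h < d -> h <= t -> f t <= f (t - h) + eps) ->
  f b <= f 0.
Proof.
  intros Hb Hright Hleft.
  assert (Hall : forall eps, 0 < eps -> f b <= f 0 + eps * b).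
  { intros eps Heps.
    set (E := fun t => 0 <= t <= b /\ forall s, 0 <= s <= t -> f s <= f 0 + eps * s).
    destruct (completeness E) as [m [Hub Hleast]].
    { exists b. intros t [Ht _]. lra. }
    { exists 0. split; [lra|]. intros s Hs. replace s with 0 by lra. lra. }
    assert (Hm0 : 0 <= m).
    { apply Hub. split; [lra|]. intros s Hs. replace s with 0 by lra. lra. }
    assert (Hmb : m <= b) by (apply Hleast; intros t [Ht _]; lra).
    assert (Hbelow : forall s, 0 <= s < m -> f s <= f 0 + eps * s).
    { intros s Hs. apply NNPP; intros Hno.
      assert (is_upper_bound E s).
      { intros t [Ht Hts]. apply Rnot_lt_le; intros Hlt. apply Hno, Hts; lra. }
      specialize (Hleast s H). lra. }
    assert (Hm : f m <= f 0 + eps * m).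
    { destruct (Req_dec m 0) as [->|Hm]; [lra|].
      apply le_epsilon; intros eps' Heps'.
      destruct (Hleft m eps') as (d & Hd & Hh); [lra|lra|].
      assert (Hmin : 0 < Rmin (d / 2) (m / 2)) by (apply Rmin_glb_lt; lra).
      generalize (Rmin_l (d / 2) (m / 2)) (Rmin_r (d / 2) (m / 2)); intros.
      specialize (Hh (Rmin (d / 2) (m / 2))).
      specialize (Hbelow (m - Rmin (d / 2) (m / 2))).
      specialize (Hh ltac:(lra) ltac:(lra)). specialize (Hbelow ltac:(lra)).
      nra. }
    assert (Hmeq : m = b).
    { destruct (Rle_lt_or_eq_dec m b Hmb) as [Hlt|]; [|assumption]. exfalso.
      destruct (Hright m eps) as (d & Hd & Hh); [lra|lra|].
      assert (Hmin : 0 < Rmin (d / 2) (b - m)) by (apply Rmin_glb_lt; lra).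
      generalize (Rmin_l (d / 2) (b - m)) (Rmin_r (d / 2) (b - m)); intros.
      assert (HE : E (m + Rmin (d / 2) (b - m))).
      { split; [lra|]. intros s Hs.
        destruct (Rle_lt_dec s m) as [Hsm|Hsm].
        - destruct (Req_dec s m) as [->|]; [exact Hm|apply Hbelow; lra].
        - specialize (Hh (s - m) ltac:(lra)).
          replace (m + (s - m)) with s in Hh by ring. nra. }
      specialize (Hub _ HE). lra. }
    rewrite <- Hmeq. exact Hm. }
  apply le_epsilon; intros e He.
  specialize (Hall (e / (b + 1)) ltac:(apply Rdiv_lt_0_compat; lra)).
  enough (e / (b + 1) * b <= e) by lra.
  apply Rmult_le_reg_r with (b + 1); [lra|].
  replace (e / (b + 1) * b * (b + 1)) with (e * b) by (field; lra). nra.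
Qed.

(** Otherwise [a] would dominate a multiple of the harmonic series, whose
    partial sums are bounded below by a logarithm. *)
Lemma summable_liminf_weighted (a : nat -> R) (eps : R) (N0 : nat) :
  (forall n, 0 <= a n) -> ex_series a -> 0 < eps ->
  exists N, (N0 <= N)%nat /\ (INR N + 1) * a N <= eps.
Proof.
  intros Ha Hex Heps. apply NNPP; intros Hno.
  assert (Hbig : forall N, (N0 <= N)%nat -> eps / (INR N + 1) < a N).
  { intros N HN. apply Rnot_le_lt; intros Hle. apply Hno. exists N; split; [exact HN|].
    generalize (pos_INR N); intros HN0.
    apply Rmult_le_compat_l with (r := INR N + 1) in Hle; [|lra].
    replace ((INR N + 1) * (eps / (INR N + 1))) with eps in Hle by (field; lra).
    exact Hle. }
  assert (Hlog : forall N, ln (INR N + 2) - ln (INR N + 1) <= / (INR N + 1)).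
  { intros N. generalize (pos_INR N); intros HN0.
    rewrite <- ln_div by lra.
    rewrite <- (ln_exp (/ (INR N + 1))). apply ln_le.
    - apply Rdiv_lt_0_compat; lra.
    - replace ((INR N + 2) / (INR N + 1)) with (1 + / (INR N + 1)) by (field; lra).
      apply exp_ineq1_le. }
  assert (Hsum : forall j, eps * (ln (INR (N0 + j) + 2) - ln (INR N0 + 1))
                           <= sum_n a (N0 + j)).
  { induction j as [|j IH].
    - rewrite Nat.add_0_r.
      apply Rle_trans with (a N0).
      + apply Rle_trans with (eps * / (INR N0 + 1)).
        * apply Rmult_le_compat_l; [lra | apply Hlog].
        * apply Rlt_le, Hbig; lia.
      + destruct N0 as [|M]; [rewrite sum_O; lra|]. rewrite sum_Sn.
        generalize (sum_n_nonneg a M Ha). change plus with Rplus. cbv beta. lra.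
    - rewrite Nat.add_succ_r, sum_Sn. change plus with Rplus. cbv beta.
      generalize (Hbig (S (N0 + j)) ltac:(lia)) (Hlog (S (N0 + j))).
      unfold Rdiv. rewrite S_INR.
      replace (INR (N0 + j) + 1 + 1) with (INR (N0 + j) + 2) by ring.
      intros H1 H2. apply Rmult_le_compat_l with (r := eps) in H2; lra. }
  set (A := Series a).
  set (B := A / eps + ln (INR N0 + 1)).
  destruct (INR_unbounded (exp B)) as [j Hj].
  specialize (Hsum j).
  generalize (sum_n_le_Series a (N0 + j) Ha Hex); fold A; intros HA.
  assert (HB : B < ln (INR (N0 + j) + 2)).
  { rewrite <- (ln_exp B). apply ln_increasing; [apply exp_pos|].
    rewrite plus_INR. generalize (pos_INR N0). lra. }
  assert (H : eps * (A / eps) < eps * (ln (INR (N0 + j) + 2) - ln (INR N0 + 1)))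
    by (apply Rmult_lt_compat_l; [exact Heps | unfold B in HB; lra]).
  replace (eps * (A / eps)) with A in H by (field; lra). lra.
Qed.

(** * Dissipativity of the Laguerre operator above a barrier *)

Section Laguerre.
Variable alpha : R.
Hypothesis Halpha : -1 < alpha.

Lemma pochhammer_pos n : 0 < pochhammer (alpha + 1) n.
Proof.
  induction n as [|n IH]; simpl; [lra|].
  apply Rmult_lt_0_compat; [exact IH | generalize (pos_INR n); lra].
Qed.

Lemma sigma_pos n : 0 < sigma alpha n.
Proof.
  apply sqrt_lt_R0, Rdiv_lt_0_compat; [apply pochhammer_pos | apply INR_fact_lt_0].
Qed.

Lemma sigma_succ n :
  sqrt (INR n + 1) * sigma alpha (S n) = sqrt (INR n + 1 + alpha) * sigma alpha n.
Proof.
  generalize (pos_INR n); intros Hn. unfold sigma.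
  rewrite <- !sqrt_mult_alt by lra. f_equal.
  rewrite fact_simpl, mult_INR, S_INR. simpl pochhammer.
  field. split; [apply INR_fact_neq_0 | lra].
Qed.

(** The barrier is [sigma] because it is, formally, the null vector of
    [tau alpha]: it corresponds to the constant sequence under [Lmap]. *)
Definition excess (M : R) (x : nat -> C) (n : nat) : R :=
  Rmax 0 (Re (x n) - M * sigma alpha n).

Lemma excess_nonneg M x n : 0 <= excess M x n.
Proof. apply Rmax_l. Qed.

Lemma excess_le M x n : 0 <= M -> excess M x n <= Rabs (Re (x n)).
Proof.
  intros HM. unfold excess. apply Rmax_lub; [apply Rabs_pos|].
  generalize (Rle_abs (Re (x n))) (sigma_pos n). nra.
Qed.

Lemma excess_le_Cmod M x n : 0 <= M -> Rabs (excess M x n) <= Cmod (x n).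
Proof.
  intros HM. rewrite Rabs_pos_eq by apply excess_nonneg.
  apply Rle_trans with (1 := excess_le M x n HM). apply re_le_Cmod.
Qed.

Lemma excess_mul_nonneg M x n : 0 <= M -> 0 <= excess M x n * Re (x n).
Proof.
  intros HM. generalize (Rlt_le _ _ (sigma_pos n)). intros Hs.
  unfold excess, Rmax. destruct Rle_dec; [|lra].
  apply Rmult_le_pos; nra.
Qed.

Lemma Re_three_term (a b c : R) (z1 z2 z3 : C) :
  Re (- RtoC a * z1 + RtoC b * z2 - RtoC c * z3)%C
  = - a * Re z1 + b * Re z2 - c * Re z3.
Proof. destruct z1, z2, z3; simpl; ring. Qed.

Lemma Re_tau_O x :
  Re (tau alpha x 0) = (1 + alpha) * Re (x O) - sqrt (0 + 1) * sqrt (0 + 1 + alpha) * Re (x 1%nat).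
Proof.
  rewrite <- sqrt_mult_alt by lra.
  unfold tau; simpl INR. rewrite Re_three_term, Rmult_0_l, sqrt_0. ring.
Qed.

Lemma Re_tau_S x n :
  Re (tau alpha x (S n)) =
    - (sqrt (INR n + 1) * sqrt (INR n + 1 + alpha)) * Re (x n)
    + (2 * INR n + 3 + alpha) * Re (x (S n))
    - sqrt (INR (S n) + 1) * sqrt (INR (S n) + 1 + alpha) * Re (x (S (S n))).
Proof.
  generalize (pos_INR n); intros Hn.
  rewrite <- !sqrt_mult_alt by (rewrite ?S_INR; lra).
  unfold tau. rewrite Re_three_term, !S_INR.
  replace (2 * (INR n + 1) + 1 + alpha) with (2 * INR n + 3 + alpha) by ring.
  reflexivity.
Qed.

(** Discrete integration by parts.  In the variables [y n = Re (x n) / sigma n]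
    the operator is a birth-death generator that kills constants, so each
    bond [n, n+1] contributes the product of the increments of [y] and of the
    nondecreasing function [max 0 (y - M)] of [y], a nonnegative number.  What
    is left is the boundary term at the last bond. *)
Lemma excess_tau_partial_sum M x N :
  (INR N + 1 + alpha) * (excess M x N * Re (x N))
    - sqrt (INR N + 1) * sqrt (INR N + 1 + alpha) * (excess M x N * Re (x (S N)))
  <= sum_n (fun n => excess M x n * Re (tau alpha x n)) N.
Proof.
  induction N as [|N IH].
  - rewrite sum_O, Re_tau_O. simpl INR. lra.
  - rewrite sum_Sn. change plus with Rplus. cbv beta.
    apply Rle_trans with (2 := Rplus_le_compat_r _ _ _ IH).
    clear IH. rewrite Re_tau_S.
    assert (Hc := sigma_succ N).
    assert (Hp2 : sqrt (INR N + 1) * sqrt (INR N + 1) = INR N + 1)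
      by (apply sqrt_sqrt; generalize (pos_INR N); lra).
    assert (Hq2 : sqrt (INR N + 1 + alpha) * sqrt (INR N + 1 + alpha) = INR N + 1 + alpha)
      by (apply sqrt_sqrt; generalize (pos_INR N); lra).
    assert (Hp : 0 <= sqrt (INR N + 1)) by apply sqrt_pos.
    assert (Hq : 0 <= sqrt (INR N + 1 + alpha)) by apply sqrt_pos.
    rewrite S_INR.
    set (p := sqrt (INR N + 1)) in *.
    set (q := sqrt (INR N + 1 + alpha)) in *.
    clearbody p q.
    set (w := Re (x N)). set (w' := Re (x (S N))).
    (* the two increments across the bond, both multiplied by the common
       value p * sigma (N+1) = q * sigma N *)
    enough (Hbond : 0 <= (p * w' - q * w) * (p * excess M x (S N) - q * excess M x N)).
    { replace (INR N + 1 + 1 + alpha) with (p * p + 1 + alpha) by lra.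
      replace (2 * INR N + 3 + alpha) with (p * p + 1 + alpha + p * p) by lra.
      rewrite <- Hq2. nra. }
    unfold excess. fold w w'.
    rewrite <- (RmaxRmult _ _ p), <- (RmaxRmult _ _ q) by assumption.
    rewrite !Rmult_0_r, (Rmult_minus_distr_l p), (Rmult_minus_distr_l q).
    replace (p * (M * sigma alpha (S N))) with (q * (M * sigma alpha N))
      by (rewrite <- (Rmult_assoc p), (Rmult_comm p M), Rmult_assoc, Hc; ring).
    generalize (p * w') (q * w) (q * (M * sigma alpha N)). intros a b c.
    unfold Rmax. destruct (Rle_dec 0 (a - c)), (Rle_dec 0 (b - c)).
    + replace (a - c - (b - c)) with (a - b) by ring. apply Rle_0_sqr.
    + apply Rmult_le_pos; lra.
    + replace ((a - b) * (0 - (b - c))) with ((b - a) * (b - c)) by ring.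
      apply Rmult_le_pos; lra.
    + lra.
Qed.

(** The arithmetic-geometric mean inequality. *)
Lemma offdiag_le n :
  sqrt (INR n + 1) * sqrt (INR n + 1 + alpha) <= (INR n + 1) * (2 + Rabs alpha).
Proof.
  generalize (pos_INR n) (Rle_abs alpha); intros Hn Ha.
  assert (Hp2 : sqrt (INR n + 1) * sqrt (INR n + 1) = INR n + 1)
    by (apply sqrt_sqrt; lra).
  assert (Hq2 : sqrt (INR n + 1 + alpha) * sqrt (INR n + 1 + alpha) = INR n + 1 + alpha)
    by (apply sqrt_sqrt; lra).
  generalize (Rle_0_sqr (sqrt (INR n + 1) - sqrt (INR n + 1 + alpha))) (Rabs_pos alpha).
  unfold Rsqr. nra.
Qed.

(** [x] is only known to lie in the maximal domain, so the boundary term need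
    not tend to 0.  It is however at most a multiple of
    [(N + 1) |x N| |x (N + 1)|], and the products [|x N| |x (N + 1)|] are
    summable, so it is arbitrarily small along a subsequence, which is enough
    for the sign of the sum of the series. *)
Lemma excess_tau_nonneg M x : 0 <= M -> dom (laguerre alpha) x ->
  ex_series (fun n => excess M x n * Re (tau alpha x n)) /\
  0 <= Series (fun n => excess M x n * Re (tau alpha x n)).
Proof.
  intros HM [Hx Htx].
  destruct (cauchy_schwarz (excess M x) (fun n => Re (tau alpha x n)) x (tau alpha x))
    as [Hex _]; auto using excess_le_Cmod, re_le_Cmod.
  split; [exact Hex|].
  set (a := fun n => Cmod (x n) * Cmod (x (S n))).
  assert (Ha0 : forall n, 0 <= a n)
    by (intros; apply Rmult_le_pos; apply Cmod_ge_0).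
  assert (Hxs : l2 (fun n => x (S n))).
  { apply l2_sq. apply l2_sq in Hx. now apply (ex_series_incr_1 (fun n => Cmod (x n) ^ 2)). }
  assert (Ha : ex_series a).
  { apply (cauchy_schwarz (fun n => Cmod (x n)) (fun n => Cmod (x (S n)))
             x (fun n => x (S n)) Hx Hxs);
      intros n; rewrite Rabs_pos_eq; auto using Cmod_ge_0, Rle_refl. }
  apply Rnot_lt_le; intros Hneg.
  set (S0 := Series (fun n => excess M x n * Re (tau alpha x n))) in *.
  set (K := 2 + Rabs alpha).
  assert (HK : 0 < K) by (unfold K; generalize (Rabs_pos alpha); lra).
  assert (Hlim : is_lim_seq (sum_n (fun n => excess M x n * Re (tau alpha x n))) S0)
    by exact (Series_correct _ Hex).
  apply is_lim_seq_spec in Hlim.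
  assert (He : 0 < - S0 / 2) by lra.
  destruct (Hlim (mkposreal _ He)) as [N0 HN0]. cbv [pos] in HN0.
  destruct (summable_liminf_weighted a (- S0 / 2 / K) N0 Ha0 Ha) as (N & HN & Hsmall).
  { apply Rdiv_lt_0_compat; lra. }
  specialize (HN0 N HN). apply Rabs_def2 in HN0.
  generalize (excess_tau_partial_sum M x N); intros Hpart.
  assert (Hb : sqrt (INR N + 1) * sqrt (INR N + 1 + alpha)
                 * (excess M x N * Re (x (S N))) <= - S0 / 2).
  { apply Rle_trans with ((INR N + 1) * K * a N).
    - apply Rle_trans with
        (sqrt (INR N + 1) * sqrt (INR N + 1 + alpha) * a N).
      + apply Rmult_le_compat_l; [apply Rmult_le_pos; apply sqrt_pos|].
        apply Rle_trans with (1 := Rle_abs _). rewrite Rabs_mult. unfold a.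
        apply Rmult_le_compat; auto using Rabs_pos, excess_le_Cmod, re_le_Cmod.
      + apply Rmult_le_compat_r; [apply Ha0 | apply offdiag_le].
    - apply Rmult_le_compat_l with (r := K) in Hsmall; [|lra].
      replace (K * (- S0 / 2 / K)) with (- S0 / 2) in Hsmall by (field; lra). lra. }
  assert (0 <= (INR N + 1 + alpha) * (excess M x N * Re (x N))).
  { apply Rmult_le_pos; [generalize (pos_INR N); lra|].
    now apply excess_mul_nonneg. }
  lra.
Qed.

Definition energy (M : R) (x : nat -> C) : R :=
  Series (fun n => excess M x n * excess M x n).

Lemma ex_series_energy M x : 0 <= M -> l2 x ->
  ex_series (fun n => excess M x n * excess M x n).
Proof.
  intros HM Hx.
  apply (cauchy_schwarz (excess M x) (excess M x) x x); auto using excess_le_Cmod.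
Qed.

(** [max 0 p ^ 2] is a C^1 function of [p] whose derivative [2 * max 0 p] is
    2-Lipschitz. *)
Lemma sq_pos_part_taylor p d :
  Rmax 0 (p + d) * Rmax 0 (p + d) <= Rmax 0 p * Rmax 0 p + 2 * (Rmax 0 p * d) + d ^ 2.
Proof.
  unfold Rmax. destruct (Rle_dec 0 (p + d)), (Rle_dec 0 p).
  - right; ring.
  - assert ((p + d) * (p + d) <= d * d) by (apply Rmult_le_compat; lra). lra.
  - generalize (pow2_ge_0 (p + d)). lra.
  - generalize (pow2_ge_0 d). lra.
Qed.

(** The remainder is quadratic in the norm of l^2, so it does not contribute to
    the derivative of the energy along a differentiable curve. *)
Lemma energy_taylor M x y : 0 <= M -> l2 x -> l2 y ->
  energy M y <= energy M x + 2 * Series (fun n => excess M x n * Re (y n - x n))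
                + nrm (fun n => y n - x n)%C ^ 2.
Proof.
  intros HM Hx Hy.
  assert (Hd := l2_minus _ _ Hy Hx).
  destruct (cauchy_schwarz (excess M x) (fun n => Re (y n - x n)) x (fun n => y n - x n)%C)
    as [Hcross _]; auto using excess_le_Cmod, re_le_Cmod.
  assert (HE := ex_series_energy M x HM Hx).
  rewrite (nrm_sq _ Hd). apply l2_sq in Hd. unfold energy.
  rewrite <- Series_scal_l.
  apply (ex_series_Rscal 2) in Hcross.
  rewrite <- !Series_plus; auto using ex_series_Rplus.
  apply Series_le; [|auto using ex_series_Rplus].
  intros n; split; [apply Rmult_le_pos; apply excess_nonneg|].
  apply Rle_trans with (excess M x n * excess M x n
     + 2 * (excess M x n * Re (y n - x n)) + Re (y n - x n) ^ 2).
  - unfold excess. replace (Re (y n - x n)) with (Re (y n) - Re (x n)) by reflexivity.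
    replace (Re (y n) - M * sigma alpha n)
      with (Re (x n) - M * sigma alpha n + (Re (y n) - Re (x n))) by ring.
    apply sq_pos_part_taylor.
  - apply Rplus_le_compat_l. rewrite Cmod2_alt.
    generalize (pow2_ge_0 (Im (y n - x n))). lra.
Qed.

Lemma energy_lipschitz M x y : 0 <= M -> l2 x -> l2 y ->
  energy M y <= energy M x + 2 * (nrm x * nrm (fun n => y n - x n)%C)
                + nrm (fun n => y n - x n)%C ^ 2.
Proof.
  intros HM Hx Hy.
  apply Rle_trans with (1 := energy_taylor M x y HM Hx Hy).
  destruct (cauchy_schwarz (excess M x) (fun n => Re (y n - x n)) x (fun n => y n - x n)%C)
    as [_ Hcs]; auto using excess_le_Cmod, re_le_Cmod, l2_minus.
  apply Rabs_le_between in Hcs. lra.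
Qed.

(** Dissipativity: along an approximate Euler step [y = x + h (r - tau x)] the
    energy grows at most through the error [r] and at second order. *)
Lemma energy_euler_step M x y h : 0 <= M -> 0 < h ->
  dom (laguerre alpha) x -> l2 y ->
  energy M y <= energy M x
    + 2 * h * (nrm x * nrm (fun n => RtoC (/ h) * (y n - x n) - - tau alpha x n)%C)
    + nrm (fun n => y n - x n)%C ^ 2.
Proof.
  intros HM Hh Hdom Hy.
  destruct (excess_tau_nonneg M x HM Hdom) as [Hex Hdiss].
  destruct Hdom as [Hx Htx].
  set (r := fun n => (RtoC (/ h) * (y n - x n) - - tau alpha x n)%C).
  assert (Hr : l2 r).
  { apply l2_minus; [now apply l2_scal, l2_minus|].
    now apply l2_opp. }
  destruct (cauchy_schwarz (excess M x) (fun n => Re (r n)) x r)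
    as [Hexr Hcs]; auto using excess_le_Cmod, re_le_Cmod.
  apply Rle_trans with (1 := energy_taylor M x y HM Hx Hy).
  apply Rplus_le_compat_r, Rplus_le_compat_l.
  rewrite (Series_ext _ (fun n => h * (excess M x n * Re (r n)
                                       - excess M x n * Re (tau alpha x n)))).
  - rewrite Series_scal_l, Series_minus by assumption.
    apply Rabs_le_between in Hcs. nra.
  - intros n. unfold r.
    replace (Re (RtoC (/ h) * (y n - x n) - - tau alpha x n)%C)
      with (/ h * Re (y n - x n)%C + Re (tau alpha x n)).
    + field. lra.
    + destruct (y n - x n)%C, (tau alpha x n); simpl; ring.
Qed.

End Laguerre.

(** * Strongly continuous semigroups on l^2 *)

Lemma filterlim_at_right_0_iff (f : R -> R) : (forall h, 0 <= f h) ->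
  (filterlim f (at_right 0) (locally 0) <->
   forall eps, 0 < eps -> exists d, 0 < d /\ forall h, 0 < h < d -> f h < eps).
Proof.
  intros Hf; split.
  - intros Hlim eps Heps.
    assert (Hb : locally 0 (ball 0 (mkposreal eps Heps))) by (exists (mkposreal eps Heps); auto).
    destruct (Hlim _ Hb) as [d Hd]. exists d; split; [apply cond_pos|].
    intros h Hh.
    assert (Hbh : ball 0 d h).
    { change (Rabs (h - 0) < d). rewrite Rminus_0_r, Rabs_pos_eq; lra. }
    specialize (Hd h Hbh (proj1 Hh)).
    change (Rabs (f h - 0) < eps) in Hd.
    rewrite Rminus_0_r, Rabs_pos_eq in Hd; auto.
  - intros H P [eps HP]. destruct (H eps (cond_pos eps)) as (d & Hd & Hh).
    exists (mkposreal d Hd). intros h Hball Hpos. apply HP.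
    change (Rabs (f h - 0) < eps). rewrite Rminus_0_r, Rabs_pos_eq by auto.
    change (Rabs (h - 0) < d) in Hball.
    rewrite Rminus_0_r, Rabs_pos_eq in Hball by lra. apply Hh; lra.
Qed.

Section Semigroup.
Variable T : R -> (nat -> C) -> nat -> C.
Hypothesis HT : C0_semigroup unit_weight T.

Lemma semigroup_bounded_linear t : 0 <= t -> bounded_linear (T t).
Proof.
  intros Ht. split.
  - intros u Hu. now apply (C0_maps _ _ HT).
  - intros a b u v Hu Hv. apply functional_extensionality; intros n.
    now apply (C0_linear _ _ HT).
  - now apply (C0_bounded _ _ HT).
Qed.

Lemma semigroup_add s t u : 0 <= s -> 0 <= t -> l2 u -> T (s + t) u = T s (T t u).
Proof.
  intros; apply functional_extensionality; intros n. now apply (C0_add _ _ HT).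
Qed.

Lemma semigroup_zero u : l2 u -> T 0 u = u.
Proof.
  intros; apply functional_extensionality; intros n. now apply (C0_zero _ _ HT).
Qed.

Lemma semigroup_continuous_at_0 u eps : l2 u -> 0 < eps ->
  exists d, 0 < d /\ forall h, 0 < h < d -> nrm (fun n => T h u n - u n)%C < eps.
Proof.
  intros Hu. revert eps.
  apply (filterlim_at_right_0_iff (fun h => nrm (fun n => T h u n - u n)%C)).
  - intros; apply nrm_nonneg.
  - now apply (C0_continuous _ _ HT).
Qed.

Lemma finite_prefix_bounded (f : nat -> R) K : exists B, forall k, (k < K)%nat -> f k <= B.
Proof.
  induction K as [|K [B HB]]; [exists 0; lia|].
  exists (Rmax B (f K)). intros k Hk.
  destruct (Nat.eq_dec k K) as [->|Hne]; [apply Rmax_r|].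
  apply Rle_trans with (2 := Rmax_l _ _), HB; lia.
Qed.

(** Were it false, uniform boundedness would fail along some times [t_k]
    tending to 0, although each [T (t_k) u] converges to [u].  Local boundedness
    is what turns strong continuity at 0 into left continuity of the orbits. *)
Lemma semigroup_locally_bounded : exists d K, 0 < d /\ 1 <= K /\
  forall t u, 0 <= t <= d -> l2 u -> nrm (T t u) <= K * nrm u.
Proof.
  assert (H : exists d K, 0 < d /\ forall t u, 0 < t < d -> l2 u -> nrm (T t u) <= K * nrm u).
  { apply NNPP; intros Hno.
    assert (Hbad : forall k : nat, exists t, (0 < t < / (INR k + 1)) /\
                     ~ forall u, l2 u -> nrm (T t u) <= INR k * nrm u).
    { intros k. apply NNPP; intros Hk. apply Hno.
      exists (/ (INR k + 1)), (INR k). split.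
      - apply Rinv_0_lt_compat. generalize (pos_INR k); lra.
      - intros t u Ht Hu. apply NNPP; intros Hn. apply Hk. exists t; auto. }
    apply functional_choice in Hbad. destruct Hbad as [t Ht].
    destruct (uniform_boundedness (fun k => T (t k))) as [M HM].
    - intros k. apply semigroup_bounded_linear. destruct (Ht k); lra.
    - intros u Hu.
      destruct (semigroup_continuous_at_0 u 1 Hu Rlt_0_1) as (d & Hd & Hh).
      destruct (INR_unbounded (/ d)) as [K HK].
      destruct (finite_prefix_bounded (fun k => nrm (T (t k) u)) K) as [B HB].
      exists (Rmax B (nrm u + 1)). intros k.
      destruct (Nat.lt_ge_cases k K) as [Hlt|Hge].
      { apply Rle_trans with (2 := Rmax_l _ _), HB, Hlt. }
      apply Rle_trans with (2 := Rmax_r _ _).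
      destruct (Ht k) as [Htk _].
      assert (Htd : t k < d).
      { apply Rlt_le_trans with (1 := proj2 Htk).
        rewrite <- (Rinv_inv d). apply Rinv_le_contravar.
        - now apply Rinv_0_lt_compat.
        - apply le_INR in Hge. lra. }
      specialize (Hh (t k) (conj (proj1 Htk) Htd)).
      replace (T (t k) u) with (fun n => (T (t k) u n - u n) + u n)%C
        by (apply functional_extensionality; intros; ring).
      eapply Rle_trans; [apply nrm_triangle; auto|lra].
      apply l2_minus; auto. apply (C0_maps _ _ HT); [lra|auto].
    - destruct (INR_unbounded M) as [k Hk].
      apply (Ht k). intros u Hu. apply Rle_trans with (1 := HM k u Hu).
      apply Rmult_le_compat_r; [apply nrm_nonneg|lra]. }
  destruct H as (d & K & Hd & HK).
  exists (d / 2), (Rmax 1 K). split; [lra|]. split; [apply Rmax_l|].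
  intros t u Ht Hu. generalize (nrm_nonneg u); intros Hn.
  destruct (Req_dec t 0) as [->|Ht0].
  - rewrite semigroup_zero by assumption. generalize (Rmax_l 1 K). nra.
  - apply Rle_trans with (1 := HK t u ltac:(lra) Hu).
    apply Rmult_le_compat_r; [exact Hn | apply Rmax_r].
Qed.

Lemma generator_at_iff u v :
  generator_at unit_weight T u v <->
  forall eps, 0 < eps -> exists d, 0 < d /\ forall h, 0 < h < d ->
    nrm (fun n => RtoC (/ h) * (T h u n - u n) - v n)%C < eps.
Proof.
  apply (filterlim_at_right_0_iff
           (fun h => nrm (fun n => RtoC (/ h) * (T h u n - u n) - v n)%C)).
  intros; apply nrm_nonneg.
Qed.

(** [T t] commutes with the difference quotients at 0 and is bounded. *)
Lemma generator_at_semigroup t u v : 0 <= t -> l2 u -> l2 v ->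
  generator_at unit_weight T u v -> generator_at unit_weight T (T t u) (T t v).
Proof.
  intros Ht Hu Hv. rewrite !generator_at_iff. intros H eps Heps.
  assert (HB := semigroup_bounded_linear t Ht).
  destruct (bl_bounded _ HB) as [M HM].
  destruct (H (eps / (Rabs M + 1))) as (d & Hd & Hh).
  { apply Rdiv_lt_0_compat; [exact Heps | generalize (Rabs_pos M); lra]. }
  exists d; split; [exact Hd|]. intros h Hhd. specialize (Hh h Hhd).
  assert (HTh : l2 (T h u)) by (apply (C0_maps _ _ HT); [lra|exact Hu]).
  replace (fun n => RtoC (/ h) * (T h (T t u) n - T t u n) - T t v n)%C
    with (T t (fun n => RtoC (/ h) * (T h u n - u n) - v n)%C).
  - eapply Rle_lt_trans; [apply HM; auto using l2_minus, l2_scal|].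
    assert (Hq : forall z, 0 <= z < eps / (Rabs M + 1) -> M * z < eps).
    { intros z Hz. apply Rle_lt_trans with (Rabs M * z).
      - apply Rmult_le_compat_r; [lra | apply Rle_abs].
      - generalize (Rabs_pos M); intros HM0.
        apply Rle_lt_trans with ((Rabs M + 1) * z); [nra|].
        replace eps with ((Rabs M + 1) * (eps / (Rabs M + 1))) by (field; lra).
        apply Rmult_lt_compat_l; lra. }
    apply Hq. split; [apply nrm_nonneg | exact Hh].
  - rewrite (bl_minus (T t)) by auto using l2_minus, l2_scal.
    rewrite (bl_scal (T t)) by auto using l2_minus.
    rewrite (bl_minus (T t)) by auto.
    rewrite <- !semigroup_add by (auto; lra). now rewrite (Rplus_comm t h).
Qed.

End Semigroup.

(** * Truncation *)

Definition truncate (N : nat) (u : nat -> C) (n : nat) : C :=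
  if (n <? N)%nat then u n else 0.

Lemma l2_truncate N u : l2 (truncate N u).
Proof.
  apply (l2_finite_support N). intros n Hn. unfold truncate.
  now rewrite (proj2 (Nat.ltb_ge n N)).
Qed.

(** [tau alpha] is a band operator, so it preserves finite support. *)
Lemma laguerre_dom_truncate alpha N u : dom (laguerre alpha) (truncate N u).
Proof.
  split; [apply l2_truncate|]. apply (l2_finite_support (S N)).
  intros n Hn. destruct n as [|n]; [lia|]. unfold tau, truncate.
  rewrite (proj2 (Nat.ltb_ge n N)), (proj2 (Nat.ltb_ge (S n) N)),
    (proj2 (Nat.ltb_ge (S (S n)) N)) by lia.
  ring.
Qed.

Lemma truncate_approx u eps : l2 u -> 0 < eps ->
  exists N, nrm (fun n => u n - truncate N u n)%C < eps.
Proof.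
  intros Hu Heps.
  set (a := fun n => Cmod (u n) ^ 2).
  assert (Ha : ex_series a) by now apply l2_sq.
  assert (Hlim : is_lim_seq (sum_n a) (Series a)) by exact (Series_correct _ Ha).
  apply is_lim_seq_spec in Hlim.
  assert (He2 : 0 < eps ^ 2) by (apply pow_lt; exact Heps).
  destruct (Hlim (mkposreal _ He2)) as [N HN]. cbv [pos] in HN.
  specialize (HN N (le_n N)). rewrite sum_n_Reals in HN.
  exists (S N).
  set (v := fun n => (u n - truncate (S N) u n)%C).
  assert (Hv : l2 v) by (apply l2_minus; auto using l2_truncate).
  apply Rsqr_incrst_0; [|apply nrm_nonneg|lra].
  rewrite !Rsqr_pow2, (nrm_sq v Hv).
  rewrite (Series_incr_n _ (S N)); [|lia|now apply l2_sq].
  rewrite (Series_incr_n a (S N)) in HN by (lia || exact Ha).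
  simpl Nat.pred in *.
  rewrite sum_eq_R0.
  - rewrite (Series_ext _ (fun k => a (S N + k)%nat)).
    + apply Rabs_def2 in HN. lra.
    + intros n. unfold v, a, truncate.
      rewrite (proj2 (Nat.ltb_ge (S N + n) (S N))) by lia.
      do 2 f_equal. ring.
  - intros n Hn. unfold v, truncate.
    rewrite (proj2 (Nat.ltb_lt n (S N))) by lia.
    replace (u n - u n)%C with (RtoC 0) by ring. rewrite Cmod_0. ring.
Qed.

(** * The barrier is respected by the semigroup *)

Section LaguerreSemigroup.
Variable alpha : R.
Hypothesis Halpha : -1 < alpha.
Variable T : R -> (nat -> C) -> nat -> C.
Hypothesis HT : exp_semigroup unit_weight (laguerre alpha) T.

Lemma laguerre_dom_invariant t x : 0 <= t -> dom (laguerre alpha) x ->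
  dom (laguerre alpha) (T t x) /\
  generator_at unit_weight T (T t x) (fun n => - tau alpha (T t x) n)%C.
Proof.
  destruct HT as [HC HG]. intros Ht Hdom. destruct (Hdom) as [Hx Htx].
  assert (Hmx : l2 (fun n => - tau alpha x n)%C) by now apply l2_opp.
  assert (Hgen : generator_at unit_weight T x (fun n => - tau alpha x n)%C)
    by (apply HG; auto).
  apply (generator_at_semigroup T HC t) in Hgen; auto.
  assert (H := Hgen). apply HG in H; try (apply (C0_maps _ _ HC); auto).
  destruct H as [Hd Heq]. split; [exact Hd|].
  replace (fun n => - tau alpha (T t x) n)%C with (T t (fun n => - tau alpha x n)%C);
    [exact Hgen|].
  apply functional_extensionality; exact Heq.
Qed.

(** Near [t] the orbit follows an Euler step of [- tau alpha] with an error that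
    is small compared to [h], so its energy cannot grow at a positive rate. *)
Lemma energy_right_dini M x t eps : 0 <= M -> dom (laguerre alpha) x ->
  0 <= t -> 0 < eps ->
  exists d, 0 < d /\ forall h, 0 < h < d ->
    energy alpha M (T (t + h) x) <= energy alpha M (T t x) + eps * h.
Proof.
  intros HM Hx Ht Heps.
  assert (HC := proj1 HT).
  destruct (laguerre_dom_invariant t x Ht Hx) as [Hdom Hgen].
  set (y := T t x) in *.
  assert (Hy : l2 y) by apply Hdom. assert (Hty : l2 (tau alpha y)) by apply Hdom.
  set (X := nrm y). set (V := nrm (tau alpha y)).
  assert (HX : 0 <= X) by apply nrm_nonneg. assert (HV : 0 <= V) by apply nrm_nonneg.
  (* the linear error 2 h X |r| and the quadratic one, at most (h (1 + V))^2,
     each get half of eps * h *)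
  assert (He1 : 0 < eps / (4 * (X + 1))) by (apply Rdiv_lt_0_compat; lra).
  destruct (proj1 (generator_at_iff T _ _) Hgen (Rmin 1 (eps / (4 * (X + 1)))))
    as (d & Hd & Hh); [apply Rmin_glb_lt; lra|].
  assert (He2 : 0 < eps / (2 * (1 + V) ^ 2)).
  { apply Rdiv_lt_0_compat; [lra|]. generalize (pow_lt (1 + V) 2). lra. }
  exists (Rmin d (eps / (2 * (1 + V) ^ 2))). split; [now apply Rmin_glb_lt|].
  intros h Hhd.
  assert (Hhd1 : h < d) by (apply Rlt_le_trans with (1 := proj2 Hhd), Rmin_l).
  assert (Hhd2 : h < eps / (2 * (1 + V) ^ 2))
    by (apply Rlt_le_trans with (1 := proj2 Hhd), Rmin_r).
  specialize (Hh h (conj (proj1 Hhd) Hhd1)).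
  set (r := fun n => (RtoC (/ h) * (T h y n - y n) - - tau alpha y n)%C) in *.
  rewrite Rplus_comm, (semigroup_add T HC) by (lra || apply Hx). fold y.
  assert (HTy : l2 (T h y)) by (apply (C0_maps _ _ HC); [lra|exact Hy]).
  apply Rle_trans with (1 := energy_euler_step alpha Halpha M y (T h y) h HM
                               (proj1 Hhd) Hdom HTy).
  fold r. fold X.
  assert (Hr : l2 r).
  { apply l2_minus; [now apply l2_scal, l2_minus|].
    now apply l2_opp. }
  assert (Hr1 : nrm r < 1) by (apply Rlt_le_trans with (1 := Hh), Rmin_l).
  assert (Hr2 : nrm r < eps / (4 * (X + 1)))
    by (apply Rlt_le_trans with (1 := Hh), Rmin_r).
  assert (Hinc : nrm (fun n => T h y n - y n)%C <= h * (1 + V)).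
  { replace (fun n => T h y n - y n)%C with (fun n => RtoC h * (r n - tau alpha y n))%C.
    - rewrite nrm_scal, Cmod_R, Rabs_pos_eq by lra.
      apply Rmult_le_compat_l; [lra|].
      eapply Rle_trans; [apply nrm_minus_triangle; auto|]. unfold V. lra.
    - apply functional_extensionality; intros n. unfold r.
      rewrite RtoC_inv by lra. field. intros E. apply RtoC_inj in E. lra. }
  assert (Hsq : nrm (fun n => T h y n - y n)%C ^ 2 <= h * (eps / 2)).
  { apply Rle_trans with ((h * (1 + V)) ^ 2).
    - apply pow_incr. split; [apply nrm_nonneg | exact Hinc].
    - replace ((h * (1 + V)) ^ 2) with (h * (h * (1 + V) ^ 2)) by ring.
      apply Rmult_le_compat_l; [lra|].
      replace (eps / 2) with (eps / (2 * (1 + V) ^ 2) * (1 + V) ^ 2) by (field; lra).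
      apply Rmult_le_compat_r; [apply pow2_ge_0|lra]. }
  assert (Hlin : X * nrm r <= eps / 4).
  { apply Rle_trans with ((X + 1) * (eps / (4 * (X + 1)))).
    - apply Rmult_le_compat; auto using nrm_nonneg; lra.
    - right; field; lra. }
  apply Rmult_le_compat_l with (r := 2 * h) in Hlin; [|lra]. lra.
Qed.

(** The energy vanishes at time 0 and does not grow.  The time interval on which
    the orbits are uniformly bounded depends on [T] only, neither on [x] nor on
    [M], so that the argument can be restarted. *)
Lemma barrier_dom_small_time : exists d, 0 < d /\ forall M x t,
  0 <= M -> dom (laguerre alpha) x -> 0 <= t <= d ->
  (forall n, Re (x n) <= M * sigma alpha n) ->
  forall n, Re (T t x n) <= M * sigma alpha n.
Proof.
  assert (HC := proj1 HT).
  destruct (semigroup_locally_bounded T HC) as (d & K & Hd & HK & Hbd).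
  exists d; split; [exact Hd|]. intros M x b HM Hdom Hb Hbar n.
  assert (Hx : l2 x) by apply Hdom.
  assert (Hl2 : forall t, 0 <= t -> l2 (T t x))
    by (intros; now apply (C0_maps _ _ HC)).
  assert (Hdecr : energy alpha M (T b x) <= energy alpha M (T 0 x)).
  { apply (nonincreasing_of_right_dini (fun t => energy alpha M (T t x)) b); [lra| |].
    - intros t eps Ht Heps. apply energy_right_dini; auto; lra.
    - intros t eps Ht Heps.
      set (X := nrm x). assert (HX : 0 <= X) by apply nrm_nonneg.
      (* [T t x - T (t - h) x] is [T (t - h)] applied to [T h x - x], of norm at
         most K rho; since rho <= 1 the energy grows by at most
         K^2 rho (2 X + 1) *)
      set (eta := Rmin 1 (eps / (K * K * (2 * X + 1)))).
      assert (HKX : 0 < K * K * (2 * X + 1)) by (apply Rmult_lt_0_compat; nra).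
      assert (Heta : 0 < eta)
        by (apply Rmin_glb_lt; [lra | now apply Rdiv_lt_0_compat]).
      destruct (semigroup_continuous_at_0 T HC x eta Hx Heta) as (d' & Hd' & Hh).
      exists d'; split; [exact Hd'|]. intros h Hhd Hht. specialize (Hh h Hhd).
      assert (Hx1 : l2 (T (t - h) x)) by (apply Hl2; lra).
      assert (Hx2 : l2 (T t x)) by (apply Hl2; lra).
      apply Rle_trans with
        (1 := energy_lipschitz alpha Halpha M (T (t - h) x) (T t x) HM Hx1 Hx2).
      rewrite Rplus_assoc. apply Rplus_le_compat_l.
      set (rho := nrm (fun n => T h x n - x n)%C) in Hh.
      assert (Hrho : 0 <= rho) by apply nrm_nonneg.
      assert (Hdiff : nrm (fun n => T t x n - T (t - h) x n)%C <= K * rho).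
      { replace (fun n => T t x n - T (t - h) x n)%C
          with (T (t - h) (fun n => T h x n - x n)%C).
        - apply Hbd; [lra|]. apply l2_minus; [apply Hl2; lra | exact Hx].
        - rewrite (bl_minus (T (t - h)));
            [|apply semigroup_bounded_linear; auto; lra | apply Hl2; lra | exact Hx].
          rewrite <- (semigroup_add T HC) by (auto; lra).
          now replace (t - h + h) with t by ring. }
      assert (Hn1 : nrm (T (t - h) x) <= K * X) by (apply Hbd; auto; lra).
      set (D := nrm (fun n => T t x n - T (t - h) x n)%C) in *.
      assert (HD : 0 <= D) by apply nrm_nonneg.
      assert (Hr1 : rho <= 1) by (unfold eta in Hh; generalize (Rmin_l 1 (eps / (K * K * (2 * X + 1)))); lra).
      assert (Hr2 : rho * (K * K * (2 * X + 1)) <= eps).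
      { replace eps with (eps / (K * K * (2 * X + 1)) * (K * K * (2 * X + 1)))
          by (field; nra).
        apply Rmult_le_compat_r; [lra|].
        generalize (Rmin_r 1 (eps / (K * K * (2 * X + 1)))). fold eta. lra. }
      apply Rle_trans with (2 := Hr2).
      assert (nrm (T (t - h) x) * D <= K * X * (K * rho))
        by (apply Rmult_le_compat; auto using nrm_nonneg).
      assert (D ^ 2 <= (K * rho) ^ 2) by (apply pow_incr; lra).
      assert ((K * rho) ^ 2 <= K * K * rho).
      { replace ((K * rho) ^ 2) with (K * K * rho * rho) by ring.
        rewrite <- (Rmult_1_r (K * K * rho)) at 2.
        apply Rmult_le_compat_l; [|exact Hr1]. apply Rmult_le_pos; nra. }
      lra. }
  rewrite (semigroup_zero T HC) in Hdecr by exact Hx.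
  assert (H0 : energy alpha M x = 0).
  { unfold energy.
    rewrite (Series_ext _ (fun n => 0 * 0)).
    - rewrite Series_scal_l. ring.
    - intros k. unfold excess. rewrite Rmax_left; [reflexivity|].
      generalize (Hbar k). lra. }
  assert (Hterm : excess alpha M (T b x) n * excess alpha M (T b x) n <= 0).
  { rewrite <- H0. apply Rle_trans with (2 := Hdecr).
    apply (term_le_Series (fun n => excess alpha M (T b x) n * excess alpha M (T b x) n)).
    - intros k; apply Rle_0_sqr.
    - apply ex_series_energy; auto. apply Hl2; lra. }
  assert (Hge : Re (T b x n) - M * sigma alpha n <= excess alpha M (T b x) n)
    by apply Rmax_r.
  generalize (excess_nonneg alpha M (T b x) n). intros. nra.
Qed.

(** Truncations lie in the domain, approximate [x], and remain below the barrier
    because [0 <= M]. *)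
Lemma barrier_small_time : exists d, 0 < d /\ forall M x t,
  0 <= M -> l2 x -> 0 <= t <= d ->
  (forall n, Re (x n) <= M * sigma alpha n) ->
  forall n, Re (T t x n) <= M * sigma alpha n.
Proof.
  assert (HC := proj1 HT).
  destruct barrier_dom_small_time as (d & Hd & Hbar).
  exists d; split; [exact Hd|]. intros M x t HM Hx Ht Hxb n.
  assert (HB := semigroup_bounded_linear T HC t (proj1 Ht)).
  destruct (bl_bounded _ HB) as [K HK].
  apply le_epsilon; intros eps Heps.
  destruct (truncate_approx x (eps / (Rabs K + 1)) Hx) as [N HN].
  { apply Rdiv_lt_0_compat; [exact Heps | generalize (Rabs_pos K); lra]. }
  assert (Htr : Re (T t (truncate N x) n) <= M * sigma alpha n).
  { apply Hbar; auto using laguerre_dom_truncate.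
    intros k. unfold truncate. destruct (k <? N)%nat; [apply Hxb|].
    simpl. apply Rmult_le_pos; [exact HM | now apply Rlt_le, sigma_pos]. }
  set (z := fun n => (x n - truncate N x n)%C) in *.
  assert (Hz : l2 z) by (apply l2_minus; auto using l2_truncate).
  assert (Hgap : Re (T t x n) - Re (T t (truncate N x) n) <= eps).
  { replace (Re (T t x n) - Re (T t (truncate N x) n)) with (Re (T t z n)).
    - apply Rle_trans with (1 := Rle_abs _).
      apply Rle_trans with (1 := re_le_Cmod _).
      apply Rle_trans with (1 := coord_le_nrm _ n (bl_maps _ HB z Hz)).
      apply Rle_trans with (1 := HK z Hz).
      generalize (Rle_abs K) (Rabs_pos K) (nrm_nonneg z); intros.
      apply Rle_trans with ((Rabs K + 1) * nrm z); [nra|].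
      replace eps with ((Rabs K + 1) * (eps / (Rabs K + 1))) by (field; lra).
      apply Rmult_le_compat_l; lra.
    - unfold z. rewrite (bl_minus (T t)) by auto using l2_truncate. reflexivity. }
  lra.
Qed.

Lemma barrier M x t : 0 <= M -> l2 x -> 0 <= t ->
  (forall n, Re (x n) <= M * sigma alpha n) ->
  forall n, Re (T t x n) <= M * sigma alpha n.
Proof.
  assert (HC := proj1 HT).
  destruct barrier_small_time as (d & Hd & Hbar). intros HM Hx Ht Hxb.
  assert (Hiter : forall k s, 0 <= s <= INR k * d ->
            forall n, Re (T s x n) <= M * sigma alpha n).
  { induction k as [|k IH]; intros s Hs.
    - simpl in Hs. replace s with 0 by lra. now rewrite (semigroup_zero T HC).
    - rewrite S_INR in Hs.
      destruct (Rle_lt_dec s d) as [Hsd|Hsd]; [apply Hbar; auto; lra|].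
      replace s with (d + (s - d)) by ring.
      rewrite (semigroup_add T HC) by (auto; lra).
      apply Hbar; auto; [|lra|apply IH; lra].
      apply (C0_maps _ _ HC); auto; lra. }
  destruct (INR_unbounded (t / d)) as [k Hk].
  apply (Hiter k). split; [exact Ht|].
  apply Rmult_lt_compat_r with (r := d) in Hk; [|exact Hd].
  replace (t / d * d) with t in Hk by (field; lra). lra.
Qed.

(** By linearity [c] moves into the argument of [T t].  Varying [c] yields all
    half-planes that contain 0, and positivity and contractivity are
    intersections of such constraints. *)
Lemma half_plane_barrier c M x t : 0 <= M -> l2 x -> 0 <= t ->
  (forall n, Re (c * x n) <= M * sigma alpha n) ->
  forall n, Re (c * T t x n) <= M * sigma alpha n.
Proof.
  intros HM Hx Ht H n.
  generalize (barrier M (fun n => c * x n)%C t HM (l2_scal c x Hx) Ht H n).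
  rewrite (bl_scal (T t)); auto. apply semigroup_bounded_linear; [apply HT|exact Ht].
Qed.

(** The half-line of nonnegative reals is cut out by the three half-planes with
    normals [-1], [Ci], [- Ci] and [M = 0]. *)
Lemma semigroup_nonneg x t : l2 x -> 0 <= t -> nonneg_seq x -> nonneg_seq (T t x).
Proof.
  intros Hx Ht Hpos n.
  assert (Hhp : forall c : C, (forall n, Re (c * x n) <= 0) -> Re (c * T t x n) <= 0).
  { intros c Hc. rewrite <- (Rmult_0_l (sigma alpha n)).
    apply half_plane_barrier; auto; [lra|]. intros k. rewrite Rmult_0_l. apply Hc. }
  assert (H1 := Hhp (- (1))%C). assert (H2 := Hhp Ci). assert (H3 := Hhp (- Ci)%C).
  destruct (T t x n) as [a b]. simpl in *.
  assert (Hk : forall k, snd (x k) = 0 /\ 0 <= fst (x k)) by exact Hpos.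
  specialize (H1 ltac:(intros k; destruct (Hk k); lra)).
  specialize (H2 ltac:(intros k; destruct (Hk k); lra)).
  specialize (H3 ltac:(intros k; destruct (Hk k); lra)).
  lra.
Qed.

(** The disc of radius [M sigma n] is the intersection of its supporting
    half-planes; the one that decides about [z := T t x n] has normal
    [Cconj z]. *)
Lemma semigroup_sigma_bound M x t : 0 <= M -> l2 x -> 0 <= t ->
  (forall n, Cmod (x n) <= M * sigma alpha n) ->
  forall n, Cmod (T t x n) <= M * sigma alpha n.
Proof.
  intros HM Hx Ht Hb n.
  set (z := T t x n). set (c := Cconj z).
  assert (H : Re (c * T t x n) <= (Cmod z * M) * sigma alpha n).
  { apply half_plane_barrier; auto.
    - apply Rmult_le_pos; [apply Cmod_ge_0 | exact HM].
    - intros k. apply Rle_trans with (1 := Rle_abs _).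
      apply Rle_trans with (1 := re_le_Cmod _).
      unfold c. rewrite Cmod_mult, Cmod_conj, Rmult_assoc.
      apply Rmult_le_compat_l; [apply Cmod_ge_0 | apply Hb]. }
  fold z in H.
  replace (Re (c * z)) with (Cmod z * Cmod z) in H.
  - rewrite Rmult_assoc in H. destruct (Req_dec (Cmod z) 0) as [Hz|Hz].
    + rewrite Hz. apply Rmult_le_pos; [exact HM | now apply Rlt_le, sigma_pos].
    + apply Rmult_le_reg_l with (Cmod z); [|exact H].
      generalize (Cmod_ge_0 z); lra.
  - replace (Cmod z * Cmod z) with (Cmod z ^ 2) by ring.
    rewrite Cmod2_alt. unfold c. destruct z; simpl; ring.
Qed.

(** * Transport to the weighted space *)

Lemma Lmap_Lmap_inv u : Lmap alpha (Lmap_inv alpha u) = u.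
Proof.
  apply functional_extensionality; intros n. unfold Lmap, Lmap_inv.
  rewrite Cmult_assoc, <- RtoC_mult, Rinv_r; [ring|].
  generalize (sigma_pos alpha Halpha n); lra.
Qed.

Lemma Lmap_inv_Lmap u : Lmap_inv alpha (Lmap alpha u) = u.
Proof.
  apply functional_extensionality; intros n. unfold Lmap, Lmap_inv.
  rewrite Cmult_assoc, <- RtoC_mult, Rinv_l; [ring|].
  generalize (sigma_pos alpha Halpha n); lra.
Qed.

Lemma Lmap_weight u n :
  Cmod (u n) ^ 2 * sigma2 alpha n = Cmod (Lmap alpha u n) ^ 2 * unit_weight n.
Proof.
  unfold Lmap, sigma2, unit_weight.
  rewrite Cmod_mult, Cmod_R, Rabs_pos_eq by now apply Rlt_le, sigma_pos. ring.
Qed.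

Lemma ell2_sigma2 u : ell2 (sigma2 alpha) u <-> l2 (Lmap alpha u).
Proof.
  split; apply ex_series_ext; intros n; [|symmetry]; apply Lmap_weight.
Qed.

Lemma ell2_norm_sigma2 u : ell2_norm (sigma2 alpha) u = nrm (Lmap alpha u).
Proof.
  unfold ell2_norm. f_equal. apply Series_ext; intros n. apply Lmap_weight.
Qed.

Lemma Lmap_conj t u : Lmap alpha (conj_semigroup alpha T t u) = T t (Lmap alpha u).
Proof. apply Lmap_Lmap_inv. Qed.

Lemma conj_C0_semigroup : C0_semigroup (sigma2 alpha) (conj_semigroup alpha T).
Proof.
  assert (HC := proj1 HT). split.
  - intros t u Ht Hu. apply ell2_sigma2. rewrite Lmap_conj.
    apply (C0_maps _ _ HC); [exact Ht | now apply ell2_sigma2].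
  - intros t a b u v Ht Hu Hv n. apply ell2_sigma2 in Hu. apply ell2_sigma2 in Hv.
    unfold conj_semigroup.
    replace (Lmap alpha (fun k => a * u k + b * v k)%C)
      with (fun k => a * Lmap alpha u k + b * Lmap alpha v k)%C
      by (apply functional_extensionality; intros; unfold Lmap; ring).
    unfold Lmap_inv at 1. rewrite (C0_linear _ _ HC) by assumption.
    unfold Lmap_inv. ring.
  - intros t Ht. destruct (C0_bounded _ _ HC t Ht) as [M HM]. exists M.
    intros u Hu. rewrite !ell2_norm_sigma2, Lmap_conj.
    now apply HM, ell2_sigma2.
  - intros u Hu n. unfold conj_semigroup.
    rewrite (semigroup_zero T HC) by now apply ell2_sigma2.
    now rewrite Lmap_inv_Lmap.
  - intros s t u Hs Ht Hu n. unfold conj_semigroup at 1 2.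
    rewrite Lmap_conj, (semigroup_add T HC); auto. now apply ell2_sigma2.
  - intros u Hu.
    apply filterlim_ext with (fun t => nrm (fun n => T t (Lmap alpha u) n - Lmap alpha u n)%C).
    + intros t. rewrite ell2_norm_sigma2, <- Lmap_conj. f_equal.
      apply functional_extensionality; intros n. unfold Lmap. ring.
    + now apply (C0_continuous _ _ HC), ell2_sigma2.
Qed.

Lemma conj_generator_at u v :
  generator_at (sigma2 alpha) (conj_semigroup alpha T) u v <->
  generator_at unit_weight T (Lmap alpha u) (Lmap alpha v).
Proof.
  assert (Heq : forall t,
    ell2_norm (sigma2 alpha)
      (fun n => RtoC (/ t) * (conj_semigroup alpha T t u n - u n) - v n)%C
    = nrm (fun n => RtoC (/ t) * (T t (Lmap alpha u) n - Lmap alpha u n)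
                    - Lmap alpha v n)%C).
  { intros t. rewrite ell2_norm_sigma2, <- Lmap_conj. f_equal.
    apply functional_extensionality; intros n. unfold Lmap. ring. }
  split; apply filterlim_ext; intros t; now rewrite Heq.
Qed.

Lemma conj_exp_semigroup :
  exp_semigroup (sigma2 alpha) (laguerre_tilde alpha) (conj_semigroup alpha T).
Proof.
  split; [exact conj_C0_semigroup|]. intros u v Hu Hv.
  rewrite conj_generator_at.
  assert (Hu' := proj1 (ell2_sigma2 u) Hu). assert (Hv' := proj1 (ell2_sigma2 v) Hv).
  rewrite (proj2 HT _ _ Hu' Hv'). simpl.
  assert (Hval : (forall n, Lmap alpha v n = - tau alpha (Lmap alpha u) n)%C <->
                 (forall n, v n = - Lmap_inv alpha (tau alpha (Lmap alpha u)) n)%C).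
  { split; intros H n.
    - rewrite <- (Lmap_inv_Lmap v). unfold Lmap_inv. rewrite H. ring.
    - rewrite <- (Lmap_Lmap_inv (tau alpha (Lmap alpha u))).
      unfold Lmap at 1 2. rewrite H. ring. }
  tauto.
Qed.

End LaguerreSemigroup.

Theorem corollary3p5 (alpha : R) (Halpha : -1 < alpha)
    (T : R -> (nat -> C) -> nat -> C)
    (HT : exp_semigroup unit_weight (laguerre alpha) T) :
  exp_semigroup (sigma2 alpha) (laguerre_tilde alpha) (conj_semigroup alpha T) /\
  positivity_preserving (sigma2 alpha) (conj_semigroup alpha T) /\
  linfty_contractive (sigma2 alpha) (conj_semigroup alpha T).
Proof.
  split; [|split].
  - now apply conj_exp_semigroup.
  - intros t u Ht Hu Hpos.
    assert (HL : nonneg_seq (T t (Lmap alpha u))).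
    { apply (semigroup_nonneg alpha); auto; [now apply ell2_sigma2|lra|].
      intros n. destruct (Hpos n) as [Him Hre].
      generalize (sigma_pos alpha Halpha n); intros Hs.
      unfold Lmap, Re, Im in *. simpl. rewrite Him.
      split; [ring|]. rewrite Rmult_0_l, Rminus_0_r. apply Rmult_le_pos; lra. }
    intros n. destruct (HL n) as [Him Hre].
    generalize (Rinv_0_lt_compat _ (sigma_pos alpha Halpha n)); intros Hs.
    unfold conj_semigroup, Lmap_inv, Re, Im in *. simpl. rewrite Him.
    split; [ring|]. rewrite Rmult_0_l, Rminus_0_r. apply Rmult_le_pos; lra.
  - intros t u Ht Hu [B HB].
    set (s := sup_norm u).
    assert (Hle : forall n, Rbar_le (Finite (Cmod (u n))) s).
    { intros n. apply (Sup_seq_minor_le (fun n => Finite (Cmod (u n))) _ n).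
      apply Rbar_le_refl. }
    assert (Hsup : Rbar_le s (Finite B)).
    { unfold s, sup_norm.
      apply Rbar_not_lt_le; intros Hlt. apply Sup_seq_minor_lt in Hlt.
      destruct Hlt as [n Hn]. simpl in Hn. generalize (HB n); lra. }
    (* the supremum is finite, being between |u 0| and B *)
    destruct s as [M| |]; [|contradiction|destruct (Hle O)].
    simpl in Hle.
    assert (HM : 0 <= M) by (apply Rle_trans with (1 := Cmod_ge_0 (u O)), Hle).
    assert (HL : forall n, Cmod (T t (Lmap alpha u) n) <= M * sigma alpha n).
    { apply semigroup_sigma_bound; auto; [now apply ell2_sigma2|lra|].
      intros n. generalize (sigma_pos alpha Halpha n); intros Hs. unfold Lmap.
      rewrite Cmod_mult, Cmod_R, Rabs_pos_eq, Rmult_comm by lra.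
      apply Rmult_le_compat_r; [lra | apply Hle]. }
    apply Rbar_not_lt_le; intros Hlt. apply Sup_seq_minor_lt in Hlt.
    destruct Hlt as [n Hn]. simpl in Hn. apply (Rlt_irrefl M).
    apply Rlt_le_trans with (1 := Hn).
    generalize (sigma_pos alpha Halpha n); intros Hs.
    unfold conj_semigroup, Lmap_inv.
    rewrite Cmod_mult, Cmod_R, Rabs_pos_eq by now apply Rlt_le, Rinv_0_lt_compat.
    apply Rmult_le_reg_l with (sigma alpha n); [exact Hs|].
    rewrite <- Rmult_assoc, Rinv_r, Rmult_1_l, Rmult_comm by lra.
    rewrite Rmult_comm. rewrite (Rmult_comm _ M). apply HL.
Qed.
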